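(* Let $f:\mathbb{C}\to\mathbb{C}$ be a polynomial of degree $N\geq 2$, let $p$ be an attracting fixed point of $f$, and let $\Omega$ be the immediate basin of attraction of $p$ (so $p\in\Omega$). Suppose that $f^{-1}(p)\cap\Omega\neq\{p\}$. Then there is a constant $C$ such that for every point $z_0\in\Omega$ there exists a point $q\in\Omega\cap\bigcup_{k\geq 0} f^{-k}(p)$ with $d_\Omega(z_0,q)\leq C$, where $d_\Omega$ is the Kobayashi distance on $\Omega$.
   Context: A fixed point $p$ of $f$ is attracting if $|f'(p)|<1$. The basin of attraction of $p$ is $\mathcal{A}(p)=\{z\in\mathbb{C}: f^n(z)\to p \text{ as } n\to\infty\}$, where $f^n$ is the $n$-fold iterate of $f$; the immediate basin of attraction of $p$ is the connected component of $\mathcal{A}(p)$ containing $p$. For $k\ge 0$, $f^{-k}(p)=\{z\in\mathbb{C}: f^k(z)=p\}$. Kobayashi distance: let $\triangle$ be the open unit disk. For a domain $U\subset\mathbb{C}$, $z\in U$ and $\xi\in\mathbb{C}$, put $F_U(z,\xi)=\inf\{\lambda>0: \exists\, h:\triangle\to U \text{ holomorphic with } h(0)=z,\ \lambda h'(0)=\xi\}$. For a piecewise smooth curve $\gamma:[0,1]\to U$ put $L_U(\gamma)=\int_0^1 F_U(\gamma(t),\gamma'(t))\,dt$. For $z_1,z_2\in U$, $d_U(z_1,z_2)$ is the infimum of $L_U(\gamma)$ over all piecewise smooth curves $\gamma$ in $U$ joining $z_1$ to $z_2$. For $U=\triangle$ one has $F_\triangle(z,\xi)=|\xi|/(1-|z|^2)$.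 *)

(* Defs.v *)
From HB Require Import structures.
From mathcomp Require Import all_boot all_order all_algebra.
From mathcomp Require Import complex.
From mathcomp Require Import all_classical all_reals all_analysis.

Set Implicit Arguments.
Unset Strict Implicit.
Unset Printing Implicit Defensive.

Import Order.TTheory GRing.Theory Num.Theory.
Import numFieldTopology.Exports numFieldNormedType.Exports.

Local Open Scope classical_set_scope.
Local Open Scope ring_scope.
Local Open Scope complex_scope.

(* The library puts the topology and the normed C-module structure
   induced by the modulus on the regular algebra R[i]^o, not on R[i]. *)
Notation Cplx R := (R[i]^o).

Section Dynamics.
Variable R : realType.
Implicit Types (f : {poly R[i]}) (p : Cplx R).

Definition attracting_fixed_point f p : Prop :=
  f.[p] = p /\ `|(deriv f).[p]| < 1.

Definition basin f p : set (Cplx R) :=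
  [set z | (fun n => iter n (horner f) z : Cplx R) @ \oo --> p].

Definition immediate_basin f p : set (Cplx R) :=
  connected_component (basin f p) p.

Definition iter_preimage f (k : nat) p : set (Cplx R) :=
  [set z | iter k (horner f) z = p].

End Dynamics.

Section Kobayashi.
Variable R : realType.
Implicit Types (U D : set (Cplx R)) (gamma : R -> Cplx R).

Definition unit_disk : set (Cplx R) := [set z | `|z| < 1].

(* Meant for open D: complex differentiability at every point of D. *)
Definition holomorphic_on D (h : Cplx R -> Cplx R) : Prop :=
  forall z, D z -> derivable h z 1.

(* The infimum is taken in \bar R, so that it is +oo on the empty set. *)
Definition kobayashi_metric U (z xi : Cplx R) : \bar R :=
  ereal_inf [set lambda%:E | lambda in [set lambda : R | 0 < lambda /\
    exists h : Cplx R -> Cplx R,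
      [/\ holomorphic_on unit_disk h,
          (forall w, unit_disk w -> U (h w)),
          h 0 = z &
          lambda%:C * derive1 h 0 = xi]]].

(* R[i] carries no normed module structure over R in the library: the
   derivative in the real variable t is taken componentwise. *)
Definition curve_derivable gamma (t : R) : Prop :=
  derivable (fun s => complex.Re (gamma s)) t 1 /\
  derivable (fun s => complex.Im (gamma s)) t 1.

Definition curve_derive gamma (t : R) : Cplx R :=
  derive1 (fun s => complex.Re (gamma s)) t +i*
  derive1 (fun s => complex.Im (gamma s)) t.

(* For a continuous gamma, this says that gamma is C^1 on the closed interval
   [a, b], with one-sided derivatives at a and b. *)
Definition smooth_on_itv gamma (a b : R) : Prop :=
  exists v : R -> Cplx R,
    {within `[a, b], continuous v} /\
    (forall t, t \in `]a, b[ ->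
       curve_derivable gamma t /\ curve_derive gamma t = v t).

(* itv_partition 0 1 s : the breakpoints are 0 :: s, strictly increasing and
   ending at 1. *)
Definition piecewise_smooth gamma : Prop :=
  {within `[0, 1], continuous gamma} /\
  exists2 s : seq R, itv_partition 0 1 s &
    forall i, (i < size s)%N ->
      smooth_on_itv gamma (nth 0 (0 :: s) i) (nth 0 (0 :: s) i.+1).

(* A curve [0, 1] -> U is represented by a function on R of which only the
   restriction to [0, 1] matters; the finitely many t at which curve_derive is
   meaningless (breakpoints) do not affect the Lebesgue integral. *)
Definition kobayashi_length U gamma : \bar R :=
  \int[lebesgue_measure]_(t in `[0, 1])
    kobayashi_metric U (gamma t) (curve_derive gamma t).

Definition curves_joining U (z1 z2 : Cplx R) : set (R -> Cplx R) :=
  [set gamma | [/\ piecewise_smooth gamma,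
    (forall t, t \in `[0, 1] -> U (gamma t)), gamma 0 = z1 & gamma 1 = z2]].

Definition kobayashi_dist U (z1 z2 : Cplx R) : \bar R :=
  ereal_inf [set kobayashi_length U gamma | gamma in curves_joining U z1 z2].

End Kobayashi.

(* Main.v *)
Require Import Defs.
From mathcomp Require Import all_boot all_order all_algebra.
From mathcomp Require Import complex ring lra zify.
From mathcomp Require Import all_classical all_reals all_analysis.

(* Let P be the union of {p} and the forward orbits of the critical points in the
   basin; it is countable and accumulates only at p, so the immediate basin Omega
   minus P is open and any two of its points are joined by a finite chain of disks
   avoiding P. Every branch of f^-k extends over such a disk, and holomorphic
   branches do not increase the Kobayashi length; hence two points of a compact
   subset of Omega minus P have, for all k at once, preimages under f^k that are
   uniformly close in Omega.
   Choose m such that f^m maps P into a small invariant disk D around p, and let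
   V be the set of points of Omega that f^m maps into D. If z0 lies outside V, the
   last point of its orbit outside V lies in a compact set disjoint from P; it can
   be joined to a preimage q of p outside P, and lifting the chain by f^k gives
   the claim. Such a q exists: a preimage of p other than p has an infinite
   backward orbit in Omega, which cannot stay in P. If z0 lies in V, then z0 is in
   a compact subset of Omega and can be joined to p itself. *)

Set Implicit Arguments.
Unset Strict Implicit.
Unset Printing Implicit Defensive.

Import Order.TTheory GRing.Theory Num.Theory.
Import numFieldTopology.Exports numFieldNormedType.Exports.
Import Normc HBNNSimple.

Local Open Scope classical_set_scope.
Local Open Scope ring_scope.
Local Open Scope complex_scope.

(** * Derivatives and the complex modulus as a real number *)

Lemma cvg_derive1 (K : numFieldType) (V : normedModType K) (g : K -> V) (z : K) (d : V) :
  (fun h : K => h^-1 *: (g (h + z) - g z)) @ 0^' --> d ->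
  derivable g z 1 /\ derive1 g z = d.
Proof.
move=> gd; split; last by apply/cvg_lim.
by apply/cvg_ex; exists d; under eq_fun do rewrite /= [_ *: 1]mulr1.
Qed.

Section Normc.
Variable R : realType.
Implicit Types (z w : R[i]) (r e : R).

Lemma normcC r : normc r%:C = `|r|.
Proof. by rewrite /= expr0n /= addr0 sqrtr_sqr. Qed.

Lemma normc_ge0 z : 0 <= normc z.
Proof. by case: z => a b; rewrite sqrtr_ge0. Qed.

Lemma normE z : `|z| = (normc z)%:C.
Proof. by case: z. Qed.

Lemma normc_gt0 z : (0 < normc z) = (z != 0).
Proof.
rewrite lt_neqAle normc_ge0 andbT eq_sym; congr (~~ _).
by apply/eqP/eqP => [/eq0_normc//|->]; rewrite normc0.
Qed.

Lemma normc_distC z w : normc (z - w) = normc (w - z).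
Proof. by rewrite -normcN opprB. Qed.

Lemma normc_tri z w u : normc (z - u) <= normc (z - w) + normc (w - u).
Proof. by have := le_normcD (z - w) (w - u); rewrite addrA subrK. Qed.

Lemma Re_normc z : `|complex.Re z| <= normc z.
Proof. by case: z => a b /=; rewrite -sqrtr_sqr ler_wsqrtr // lerDl sqr_ge0. Qed.

Lemma Im_normc z : `|complex.Im z| <= normc z.
Proof. by case: z => a b /=; rewrite -sqrtr_sqr ler_wsqrtr // lerDr sqr_ge0. Qed.

Lemma normc_ReIm z : normc z <= `|complex.Re z| + `|complex.Im z|.
Proof.
rewrite [in X in normc X](complexE z).
apply: (le_trans (le_normcD _ _)); rewrite normcM !normcC.
by rewrite [normc 'i](_ : _ = 1) ?mul1r // /= expr0n expr1n add0r sqrtr1.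
Qed.

Lemma nbhs_normcP (z : Cplx R) (A : set (Cplx R)) :
  nbhs z A <-> exists2 r, 0 < r & forall w, normc (w - z) < r -> A w.
Proof.
rewrite -filter_from_norm_nbhs; split => [[/= e e0 eA]|[r r0 rA]].
  have eE : e = (complex.Re e)%:C by rewrite RRe_real // ger0_real // ltW.
  exists (complex.Re e); first by rewrite -ltcR -eE.
  by move=> w wz; apply: eA; rewrite /= normE eE ltcR normc_distC.
exists r%:C; first by rewrite /= ltcR.
by move=> w /=; rewrite normE ltcR normc_distC => /rA.
Qed.

Lemma cvg_normcP (u : nat -> Cplx R) (l : Cplx R) :
  u @ \oo --> l <-> forall e, 0 < e ->
    exists N, forall n, (N <= n)%N -> normc (u n - l) < e.
Proof.
split=> [ul e e0|ul].
  have /ul [N _ HN] : nbhs l [set w | normc (w - l) < e].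
    by apply/nbhs_normcP; exists e.
  by exists N => n Nn; apply: HN.
move=> A /nbhs_normcP[r r0 rA]; have [N HN] := ul r r0.
by exists N => // n /= /HN /rA.
Qed.

(** Complex differentiability with a quadratic remainder, the form in which Taylor estimates deliver
    it; [K] may have any sign. *)
Definition qderiv (g : R[i] -> R[i]) z d : Prop :=
  exists K r, 0 < r /\ forall w, normc (w - z) < r ->
    normc (g w - g z - d * (w - z)) <= K * normc (w - z) ^+ 2.

Lemma qderivP (g : Cplx R -> Cplx R) z d : qderiv g z d ->
  derivable g z 1 /\ derive1 g z = d.
Proof.
move=> [K [r [r0 H]]].
apply: cvg_derive1.
move=> A /nbhs_normcP[e e0 eA].
have : nbhs (0 : Cplx R) [set w | normc w < Num.min r (e / (`|K| + 1))].
  apply/nbhs_normcP; exists (Num.min r (e / (`|K| + 1))).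
    by rewrite lt_min r0 divr_gt0 // ltr_pwDr.
  by move=> w; rewrite subr0.
apply: filterS => w; rewrite /= lt_min => /andP[wr we] w0.
apply: eA.
have nw0 : 0 < normc w by rewrite normc_gt0.
rewrite -(ltr_pM2r nw0) -normcM.
have -> : (w^-1 *: (g (w + z) - g z : Cplx R) - d) * w = g (w + z) - g z - d * (w + z - z).
  by rewrite addrK /GRing.scale /= mulrBl mulrAC mulVf // mul1r.
have := H (w + z); rewrite addrK => /(_ wr) /le_lt_trans; apply.
rewrite expr2 mulrA ltr_pM2r //.
apply: (@le_lt_trans _ _ (`|K| * normc w)); first by rewrite ler_wpM2r ?normc_ge0 ?ler_norm.
move: we; rewrite ltr_pdivlMr ?ltr_pwDr // => /(le_lt_trans _); apply.
by rewrite mulrDr mulr1 mulrC lerDl normc_ge0.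
Qed.

End Normc.

(** * Quantitative estimates for polynomials *)

Section PolyEstimates.
Variable R : realType.
Implicit Types (z w : R[i]) (r e : R) (F : {poly R[i]}).

(** Induction along Horner's scheme [F * 'X + c]. The two bounds go together: the quadratic one for
    the new polynomial uses the linear one for [F], which also bounds [F] itself on the disk. *)
Lemma poly_taylor2 F (M : R) : 0 <= M ->
  exists2 K, 0 < K & forall z w, normc z <= M -> normc w <= M ->
    normc (F.[z] - F.[w]) <= K * normc (z - w) /\
    normc (F.[z] - F.[w] - F^`().[w] * (z - w)) <= K * normc (z - w) ^+ 2.
Proof.
move=> M0; elim/poly_ind: F => [|F c [K K0 IH]].
  exists 1 => // z w _ _; rewrite derivC !horner0 subrr mul0r subrr normc0 !mul1r.
  by rewrite normc_ge0 exprn_ge0 // normc_ge0.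
have [B B0 HB] : exists2 B, 0 < B & forall w, normc w <= M -> normc F.[w] <= B.
  exists (K * M + normc F.[0] + 1).
    by rewrite ltr_wpDl // addr_ge0 ?normc_ge0 // mulr_ge0 // ltW.
  move=> w wM; have [] := IH w 0 wM; first by rewrite normc0.
  rewrite subr0 => H _; have := le_normcD (F.[w] - F.[0]) F.[0]; rewrite subrK.
  have : K * normc w <= K * M by rewrite ler_pM2l.
  lra.
exists (K * M + B + K).
  by rewrite ltr_wpDl // addr_ge0 // ?mulr_ge0 // ltW.
move=> z w zM wM; have [H1 H2] := IH z w zM wM.
rewrite derivD derivC addr0 derivM derivX mulr1 !hornerMXaddC hornerD hornerMX.
have zw0 := normc_ge0 (z - w).
split.
  have -> : F.[z] * z + c - (F.[w] * w + c) = (F.[z] - F.[w]) * z + F.[w] * (z - w) by ring.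
  apply: (le_trans (le_normcD _ _)); rewrite !normcM.
  have : normc (F.[z] - F.[w]) * normc z <= K * normc (z - w) * M.
    by rewrite ler_pM ?normc_ge0.
  have : normc F.[w] * normc (z - w) <= B * normc (z - w) by rewrite ler_wpM2r // HB.
  have : 0 <= K * normc (z - w) by rewrite mulr_ge0 // ltW.
  nra.
have -> : F.[z] * z + c - (F.[w] * w + c) - (F^`().[w] * w + F.[w]) * (z - w) =
  (F.[z] - F.[w] - F^`().[w] * (z - w)) * w + (F.[z] - F.[w]) * (z - w) by ring.
apply: (le_trans (le_normcD _ _)); rewrite !normcM.
have : normc (F.[z] - F.[w] - F^`().[w] * (z - w)) * normc w <= K * normc (z - w) ^+ 2 * M.
  by rewrite ler_pM ?normc_ge0.
have : normc (F.[z] - F.[w]) * normc (z - w) <= K * normc (z - w) * normc (z - w).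
  by rewrite ler_wpM2r.
have : 0 <= B * normc (z - w) ^+ 2 by rewrite mulr_ge0 ?exprn_ge0 // ltW.
nra.
Qed.

(** [F - w] is its leading coefficient times a product of linear factors; if every root were at
    distance at least [e] from [z], the value at [z] would be too large. *)
Lemma near_root F z w e : (1 < size F)%N -> 0 < e ->
  normc (F.[z] - w) < normc (lead_coef F) * e ^+ (size F).-1 ->
  exists2 zeta, F.[zeta] = w & normc (z - zeta) < e.
Proof.
move=> sF e0 Fz; pose G := F - w%:P.
have sG : size G = size F by rewrite size_polyDl // size_polyN
    (leq_ltn_trans _ sF) // size_polyC leq_b1.
have lG : lead_coef G = lead_coef F by rewrite lead_coefDl // size_polyN
    (leq_ltn_trans _ sF) // size_polyC leq_b1.
have [rs rsE] := closed_field_poly_normal G; rewrite lG in rsE.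
have lF : lead_coef F != 0 by rewrite lead_coef_eq0 -size_poly_gt0 (ltn_trans _ sF).
have rsG : size rs = (size F).-1.
  by rewrite -sG rsE size_scale // size_prod_XsubC.
have GE x : G.[x] = F.[x] - w by rewrite /G hornerD hornerN hornerC.
have [/hasP[y yrs ye]|/hasPn H] := boolP (has (fun y => normc (z - y) < e) rs).
  exists y => //; apply/eqP; rewrite -subr_eq0 -GE rsE hornerZ mulf_eq0.
  by apply/orP; right; have := root_prod_XsubC rs y; rewrite yrs => /rootP ->.
exfalso; move: Fz; apply/negP; rewrite -leNgt -GE {1}rsE hornerZ normcM ler_wpM2l ?normc_ge0 //.
rewrite horner_prod -rsG; elim: (rs) H => [|y s IH] H.
  by rewrite big_nil normc1.
rewrite big_cons /= exprS normcM hornerXsubC.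
apply: ler_pM; rewrite ?exprn_ge0 ?(ltW e0) //.
  by rewrite leNgt; apply: H; rewrite mem_head.
by apply: IH => x xs; apply: H; rewrite inE xs orbT.
Qed.

Lemma root_dist_radius F e : (1 < size F)%N -> 0 < e -> exists2 d, 0 < d &
  forall z w, normc (F.[z] - w) < d -> exists2 zeta, F.[zeta] = w & normc (z - zeta) < e.
Proof.
move=> sF e0; exists (normc (lead_coef F) * e ^+ (size F).-1) => [|z w]; last exact: near_root.
by rewrite mulr_gt0 ?exprn_gt0 // normc_gt0 lead_coef_eq0 -size_poly_gt0 (ltn_trans _ sF).
Qed.

(** By [near_root] with [w = 0], a point with bounded value is at bounded distance from one of the
    finitely many roots. *)
Lemma poly_proper F (A : R) : (1 < size F)%N -> exists2 M, 0 <= M &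
  forall z, normc F.[z] <= A -> normc z <= M.
Proof.
move=> sF; have F0 : F != 0 by rewrite -size_poly_gt0 (ltn_trans _ sF).
pose l := normc (lead_coef F).
have l0 : 0 < l by rewrite normc_gt0 lead_coef_eq0.
have [rs rsE] := closed_field_poly_normal F.
have [B B0 HB] : exists2 B, 0 <= B & forall y, y \in rs -> normc y <= B.
  elim: (rs) => [|y s [B B0 IH]]; first by exists 0.
  exists (B + normc y); first by rewrite addr_ge0 ?normc_ge0.
  move=> x; rewrite inE => /predU1P[->|/IH xB]; first by rewrite lerDr.
  by rewrite (le_trans xB) // lerDl normc_ge0.
(* As [e >= 1], the threshold in [near_root] is at least [l * e = l + |A| > A]. *)
pose e := 1 + `|A| / l.
have e1 : 1 <= e by rewrite lerDl divr_ge0 // ltW.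
exists (B + e); first by rewrite addr_ge0 // (le_trans ler01).
move=> z Fz; have [|zeta zr ze] := @near_root F z 0 e sF (lt_le_trans ltr01 e1).
  rewrite subr0; apply: (le_lt_trans Fz).
  apply: (@lt_le_trans _ _ (l * e)); last first.
    rewrite ler_pM2l // -[X in X <= _]expr1 ler_weXn2l //; by case: (size F) sF => [|[]].
  rewrite mulrDr mulr1 mulrC divfK ?gt_eqF //.
  by apply: (@lt_le_trans _ _ (l + A)); [rewrite ltrDr | rewrite lerD2l ler_norm].
have zrs : zeta \in rs.
  have : root F zeta by apply/eqP.
  rewrite rsE rootZ ?lead_coef_eq0 // root_prod_XsubC //.
have := HB _ zrs; have := le_normcD (z - zeta) zeta; rewrite subrK; lra.
Qed.

End PolyEstimates.

(** * Inverse branches of a polynomial over disks without critical values *)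

Section InverseBranch.
Variable R : realType.
Implicit Types (z w c : R[i]) (r e : R) (F : {poly R[i]}).

Lemma deriv_neq0 F : (1 < size F)%N -> F^`() != 0.
Proof.
move=> sF; apply/eqP => /polyP/(_ (size F).-2); rewrite coef_deriv coef0.
case sFE: (size F) sF => [//|[//|n]] _ /= /eqP.
rewrite mulrn_eq0 /=; have -> : F`_n.+1 = lead_coef F by rewrite lead_coefE sFE.
by rewrite lead_coef_eq0 -size_poly_eq0 sFE.
Qed.

(** If the derivative is very small at [z], one of its roots is so close to [z] that the
    corresponding critical value is within [rho] of [c], which is excluded. A constant derivative
    has no root and is its own bound. *)
Lemma deriv_lower_bound F c rho r : (1 < size F)%N -> r < rho ->
  (forall y, F^`().[y] = 0 -> rho <= normc (F.[y] - c)) ->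
  exists2 m, 0 < m & forall z, normc (F.[z] - c) < r -> m <= normc F^`().[z].
Proof.
move=> sF rrho crit.
have [sF'|sF'] := leqP (size F^`()) 1.
  have := size1_polyC sF'; set k := _`_0 => kE.
  exists (normc k) => [|z _]; last by rewrite kE hornerC.
  by rewrite normc_gt0; apply: contraNneq (deriv_neq0 sF); rewrite kE => ->.
have [M M0 HM] := poly_proper (normc c + r) sF.
have [L L0 HL] := @poly_taylor2 R F (M + 1) (addr_ge0 M0 ler01).
pose e := Num.min 1 ((rho - r) / L).
have e0 : 0 < e by rewrite lt_min ltr01 divr_gt0 // subr_gt0.
have e1 : e <= 1 by rewrite ge_min lexx.
have eL : L * e <= rho - r by rewrite mulrC -ler_pdivlMr // ge_min lexx orbT.
have [m m0 Hm] := root_dist_radius sF' e0.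
exists m => // z Fz; rewrite leNgt; apply/negP => zm.
have [|y /crit Fy zy] := Hm z 0; first by rewrite subr0.
have zM : normc z <= M.
  by apply: HM; have := le_normcD (F.[z] - c) c; rewrite subrK; lra.
have yM : normc y <= M + 1.
  have := le_normcD (y - z) z; rewrite subrK normc_distC; lra.
have [|H _] := HL _ z yM; first by lra.
have : L * normc (y - z) < L * e by rewrite ltr_pM2l // normc_distC.
have := normc_tri F.[y] F.[z] c; lra.
Qed.

(** Induction on the step: the preimage [y] near [G j.+1] is joined to [G' j.+1] by four moves of
    length below [eta / 4], hence equals it by separation, and the distance is below [eta / 4]
    again. *)
Lemma normc_lift_iter F (G G' : nat -> R[i]) (eta : R) (N : nat) :
  (forall j, (j <= N)%N -> forall y, F.[y] = F.[G' j] -> normc (y - G' j) < eta -> y = G' j) ->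
  G 0%N = G' 0%N ->
  (forall j, (j < N)%N -> normc (G j.+1 - G j) < eta / 4) ->
  (forall j, (j < N)%N -> normc (G' j.+1 - G' j) < eta / 4) ->
  (forall j, (j <= N)%N -> exists2 y, F.[y] = F.[G' j] & normc (G j - y) < eta / 4) ->
  0 < eta ->
  normc (G N - G' N) < eta / 4.
Proof.
move=> inj G0 GS G'S near eta0.
suff H : forall j, (j <= N)%N -> normc (G j - G' j) < eta / 4 by apply: H.
elim=> [_|j IH jN]; first by rewrite G0 subrr normc0; lra.
have [y Fy Gy] := near _ jN; rewrite -(inj _ jN y Fy) //.
have := IH (ltnW jN); have := GS j jN; have := G'S j jN.
have := normc_tri y (G j.+1) (G' j.+1); have := normc_tri (G j.+1) (G j) (G' j.+1).
have := normc_tri (G j) (G' j) (G' j.+1).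
rewrite (normc_distC y (G j.+1)) (normc_distC (G' j) (G' j.+1)); lra.
Qed.

(* The branch is lifted along each radius in n steps, choosing at every step the
   preimage closest to the previous one. Preimages of a point are uniformly
   separated, so the lifts along two neighbouring radii stay close together;
   this replaces the monodromy argument. *)
Lemma inverse_branch F c rho r z0 : (1 < size F)%N -> 0 < r -> r < rho ->
  (forall y, F^`().[y] = 0 -> rho <= normc (F.[y] - c)) -> F.[z0] = c ->
  exists (g dg : R[i] -> R[i]) (K delta : R), [/\ 0 < delta, 0 < K, g c = z0,
    (forall w, normc (w - c) < r -> F.[g w] = w) &
    forall w w', normc (w - c) < r -> normc (w' - c) < r ->
      normc (w' - w) < delta ->
      [/\ normc (g w' - g w - dg w * (w' - w)) <= K * normc (w' - w) ^+ 2,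
          normc (dg w' - dg w) <= K * normc (w' - w) &
          normc (g w' - g w) <= K * normc (w' - w)]].
Proof.
move=> sF r0 rrho crit Fz0.
have [m m0 Hm] := deriv_lower_bound sF rrho crit.
have [M M0 HM] := poly_proper (normc c + r) sF.
have [B B0 HB] := @poly_taylor2 R F M M0.
have [B' B'0 HB'] := @poly_taylor2 R F^`() M M0.
(* For distinct [x], [y] with the same value, Taylor at [x] gives [m <= |F'(x)| <= B |y - x|]:
   preimages of a point are [eta]-separated. *)
pose eta := m / B.
have eta0 : 0 < eta by rewrite divr_gt0.
have inM z : normc (F.[z] - c) < r -> normc z <= M.
  by move=> Fz; apply: HM; have := le_normcD (F.[z] - c) c; rewrite subrK; lra.
have inj x y : normc (F.[x] - c) < r -> F.[y] = F.[x] -> normc (y - x) < eta -> y = x.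
  move=> Fx yx; have [//|yNx] := eqVneq y x.
  have Fy : normc (F.[y] - c) < r by rewrite yx.
  have [_] := HB y x (inM _ Fy) (inM _ Fx).
  rewrite yx subrr sub0r normcN normcM => H.
  have nyx : 0 < normc (y - x) by rewrite normc_gt0 subr_eq0.
  rewrite /eta ltr_pdivlMr // => H2.
  have := Hm _ Fx; have : normc F^`().[x] <= B * normc (y - x).
    by rewrite -(ler_pM2r nyx) -mulrA -expr2.
  move=> H3 H4; exfalso; lra.
have [delta d0 Hd] := root_dist_radius sF (divr_gt0 eta0 (ltr0n R 4)).
pose sel x w := xget x [set zeta | F.[zeta] = w /\ normc (x - zeta) < eta / 4].
have selP x w : normc (F.[x] - w) < delta ->
    F.[sel x w] = w /\ normc (x - sel x w) < eta / 4.
  move=> /Hd[zeta Fz xz]; rewrite /sel; case: xgetP => [y -> []//|].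
  by move=> /(_ zeta); case.
(* Enough subdivisions to make each radial step shorter than [delta], so that [sel] always finds a
   preimage within [eta / 4]. *)
pose N := (Num.truncn (r / delta)).+1.
have N0 : (0 : R) < N%:R by rewrite ltr0n.
have rN : r / N%:R < delta.
  by rewrite ltr_pdivrMr // mulrC -ltr_pdivrMr // /N truncnS_gt.
pose pt w j : R[i] := c + (j%:R / N%:R)%:C * (w - c).
pose G w := fix G j := if j is j'.+1 then sel (G j') (pt w j) else z0.
have pt0 w : pt w 0%N = c by rewrite /pt mul0r mul0r addr0.
have ptN w : pt w N = w by rewrite /pt divff ?gt_eqF // mul1r addrC subrK.
have ptS w j : pt w j - pt w j.+1 = - ((N%:R^-1)%:C * (w - c)).
  rewrite /pt opprD addrACA subrr add0r -mulrBl -rmorphB /= -mulrBl -natr1 opprD addrA subrr sub0r.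
  by rewrite mulN1r rmorphN mulNr.
have ptSr w j : normc (w - c) < r -> normc (pt w j - pt w j.+1) < delta.
  move=> wr; rewrite ptS normcN normcM normcC ger0_norm ?invr_ge0 ?ltW // mulrC.
  by rewrite (lt_trans _ rN) // ltr_pM2r ?invr_gt0.
have FG w j : normc (w - c) < r -> F.[G w j] = pt w j.
  move=> wr; elim: j => [|j IH]; first by rewrite pt0.
  by have [] := selP (G w j) (pt w j.+1); rewrite ?IH ?ptSr.
have GS w j : normc (w - c) < r -> normc (G w j.+1 - G w j) < eta / 4.
  move=> wr; rewrite normc_distC.
  by have [] := selP (G w j) (pt w j.+1); rewrite ?FG ?ptSr.
have lej j : (j <= N)%N -> 0 <= (j%:R / N%:R : R) <= 1.
  by move=> jN; rewrite divr_ge0 ?ler0n //= ler_pdivrMr // mul1r ler_nat.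
have pt_in w j : (j <= N)%N -> normc (w - c) < r -> normc (pt w j - c) < r.
  move=> /lej /andP[j0 j1] wr; rewrite /pt addrC addKr normcM normcC ger0_norm //.
  by apply: le_lt_trans wr; rewrite ler_piMl ?normc_ge0.
have close w w' : normc (w - c) < r -> normc (w' - c) < r -> normc (w' - w) < delta ->
    normc (G w' N - G w N) < eta / 4.
  move=> wr w'r ww'; apply: (@normc_lift_iter F _ _ _ N) => //.
  - by move=> j jN y; apply: inj; rewrite FG // pt_in.
  - by move=> j _; apply: GS.
  - by move=> j _; apply: GS.
  move=> j jN; apply: Hd; rewrite !FG //.
  have -> : pt w' j - pt w j = (j%:R / N%:R)%:C * (w' - w) by rewrite /pt; ring.
  have /andP[j0 j1] := lej _ jN; rewrite normcM normcC ger0_norm //.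
  by apply: le_lt_trans ww'; rewrite ler_piMl ?normc_ge0.
pose g w := G w N; pose dg w := (F^`().[g w])^-1.
have Fg w : normc (w - c) < r -> F.[g w] = w by move=> wr; rewrite FG // ptN.
pose K2 := 2 / m.
have K20 : 0 < K2 by rewrite divr_gt0.
have ginM w : normc (w - c) < r -> normc (g w) <= M.
  by move=> wr; apply: inM; rewrite Fg.
have gm w : normc (w - c) < r -> m <= normc F^`().[g w].
  by move=> wr; apply: Hm; rewrite Fg.
(* With [x = g w] and [x' = g w'], Taylor gives [m |x' - x| <= |w' - w| + B |x' - x|^2]. As
   [|x' - x| < eta / 4], the last term is at most [(m / 4) |x' - x|] and is absorbed. *)
have glip w w' : normc (w - c) < r -> normc (w' - c) < r -> normc (w' - w) < delta ->
    normc (g w' - g w) <= K2 * normc (w' - w).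
  move=> wr w'r ww'; have := close _ _ wr w'r ww'; rewrite -/(g w) -/(g w').
  set x := g w; set x' := g w' => xx'.
  have [_] := HB x' x (ginM _ w'r) (ginM _ wr); rewrite !Fg // => H.
  have H2 := le_normcD (F^`().[x] * (x' - x) - (w' - w)) (w' - w).
  rewrite subrK (normc_distC _ (w' - w)) normcM in H2.
  have H3 : m * normc (x' - x) <= normc F^`().[x] * normc (x' - x).
    by rewrite ler_wpM2r ?normc_ge0 // gm.
  have H4 : B * normc (x' - x) <= m / 4.
    rewrite mulrC -ler_pdivlMr // mulrAC; exact: ltW.
  have H5 : B * normc (x' - x) ^+ 2 <= m / 4 * normc (x' - x).
    by rewrite expr2 mulrA ler_wpM2r ?normc_ge0.
  rewrite /K2 mulrAC ler_pdivlMr //; have := normc_ge0 (w' - w); lra.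
pose K := m^-1 * (B * K2 ^+ 2) + (m ^+ 2)^-1 * (B' * K2) + K2.
have p1 : 0 < m^-1 * (B * K2 ^+ 2) by rewrite mulr_gt0 ?invr_gt0 // mulr_gt0 // exprn_gt0.
have p2 : 0 < (m ^+ 2)^-1 * (B' * K2) by rewrite mulr_gt0 ?invr_gt0 ?exprn_gt0 // mulr_gt0.
have fgn0 w : normc (w - c) < r -> F^`().[g w] != 0.
  by move=> wr; rewrite -normc_gt0 (lt_le_trans m0) // gm.
exists g, dg, K, delta; split => //.
- by rewrite /K; lra.
(* The radius to [c] is constant, but [sel] could pick any preimage within [eta / 4]; separation
   forces it to pick [z0] each time. *)
- suff : forall n, G c n = z0 by move=> /(_ N).
  elim=> [//|n IH]; rewrite /= -/(G c) IH.
  have -> : pt c n.+1 = F.[z0] by rewrite /pt subrr mulr0 addr0.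
  have [Fs sz] : F.[sel z0 F.[z0]] = F.[z0] /\ normc (z0 - sel z0 F.[z0]) < eta / 4.
    by apply: selP; rewrite subrr normc0.
  apply: inj Fs _; first by rewrite Fz0 subrr normc0.
  by rewrite normc_distC; lra.
move=> w w' wr w'r ww'; have gl := glip _ _ wr w'r ww'; split.
- have [_] := HB (g w') (g w) (ginM _ w'r) (ginM _ wr); rewrite !Fg // => H.
  have -> : g w' - g w - dg w * (w' - w) =
      - (dg w * (w' - w - F^`().[g w] * (g w' - g w))).
    by rewrite /dg; field; exact: fgn0.
  rewrite normcN normcM normcV.
  apply: (@le_trans _ _ (m^-1 * (B * K2 ^+ 2) * normc (w' - w) ^+ 2)); last first.
    by rewrite ler_wpM2r ?exprn_ge0 ?normc_ge0 // /K; lra.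
  rewrite -mulrA; apply: ler_pM; rewrite ?invr_ge0 ?normc_ge0 //.
    by rewrite lef_pV2 ?posrE ?gm // normc_gt0 fgn0.
  apply: (le_trans H); rewrite -mulrA ler_pM2l // -exprMn.
  by rewrite lerXn2r ?nnegrE ?normc_ge0 // mulr_ge0 ?normc_ge0 // ltW.
- have [H _] := HB' (g w) (g w') (ginM _ wr) (ginM _ w'r).
  have -> : dg w' - dg w = (F^`().[g w'] * F^`().[g w])^-1 * (F^`().[g w] - F^`().[g w']).
    by rewrite /dg; field; rewrite !fgn0.
  rewrite normcM normcV.
  apply: (@le_trans _ _ ((m ^+ 2)^-1 * (B' * K2) * normc (w' - w))); last first.
    by rewrite ler_wpM2r ?normc_ge0 // /K; lra.
  rewrite -mulrA; apply: ler_pM; rewrite ?invr_ge0 ?normc_ge0 //.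
    rewrite lef_pV2 ?posrE ?exprn_gt0 ?normc_gt0 ?mulf_neq0 ?fgn0 //.
    by rewrite normcM expr2; apply: ler_pM; rewrite ?(ltW m0) ?gm.
  by apply: (le_trans H); rewrite -mulrA ler_pM2l // normc_distC.
apply: (le_trans gl); rewrite ler_wpM2r ?normc_ge0 // /K; lra.
Qed.

End InverseBranch.

(** * Integrals over the unit interval and derivatives of curves *)

Section Curves.
Variable R : realType.
Implicit Types (z w : R[i]) (t a b e : R).

(** The integral is the supremum over nonnegative simple functions below [F]. Each of these is
    measurable and bounded by [M] off the null set [s], so measurability of [F], here the Kobayashi
    metric along a curve, does not have to be established. *)
Lemma integral01_le (F : R -> \bar R) (M : R) (s : seq R) : 0 <= M ->
  (forall t, t \in `[0, 1] -> (0 <= F t)%E) ->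
  (forall t, t \in `[0, 1] -> t \notin s -> (F t <= M%:E)%E) ->
  (\int[lebesgue_measure]_(t in `[0%R, 1%R]) F t <= M%:E)%E.
Proof.
move=> M0 F0 FM.
rewrite ge0_integralE; last by move=> t /= /F0.
apply: ge_ereal_sup => _ [h /= hF <-].
rewrite -integralT_nnsfun.
have <- : (\int[lebesgue_measure]_(t in setT) (cst M%:E \_ `[0%R, 1%R]) t = M%:E)%E.
  rewrite -integral_mkcond integral_cst // /= lebesgue_measure_itv /= lte01.
  by rewrite -EFinB subr0 mule1.
apply: ae_ge0_le_integral => //.
- by move=> t _; rewrite lee_fin; exact: fun_ge0.
- exact/measurable_realfun.measurable_EFinP.
- by move=> t _; rewrite /patch; case: ifP => // _; rewrite lee_fin.
- rewrite (_ : _ \_ _ = EFin \o (cst M \* \1_`[0%R, 1%R])).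
    apply/measurable_realfun.measurable_EFinP.
    by apply: measurable_realfun.measurable_funM => //; exact: measurable_realfun.measurable_indic.
  apply/funext => t; rewrite /patch /= indicE; case: ifPn => _; first by rewrite mulr1.
  by rewrite mulr0.
exists [set` s]; split.
- apply: countable_measurable; last by apply: finite_set_countable; exact: finite_seq.
  by move=> t; exact: measurable_set1.
- by apply: countable_lebesgue_measure0; apply: finite_set_countable; exact: finite_seq.
move=> t /= H; apply: contrapT => /negP ts; apply: H => _.
apply: (le_trans (hF t)); rewrite /patch; case: ifPn => // t01.
by apply: FM => //; rewrite inE in t01.
Qed.

Definition linear_approx (u : R -> R) t a := forall e, 0 < e -> exists2 r, 0 < r &
  forall x, `|x - t| < r -> `|u x - u t - (x - t) * a| <= e * `|x - t|.

Lemma linear_approxP u t a :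
  linear_approx u t a <-> derivable u t 1 /\ derive1 u t = a.
Proof.
have scaleVK (h x : R) : h != 0 -> (h^-1 *: x) * h = x.
  by move=> h0; rewrite /GRing.scale /= mulrC mulrA mulfV // mul1r.
split=> [H|[du da] e e0].
  apply: cvg_derive1; apply/cvgrPdist_le => e e0; have [r r0 Hr] := H e e0.
  rewrite near_withinE; near=> h => h0.
  have nh0 : 0 < `|h| by rewrite normr_gt0.
  rewrite -(ler_pM2r nh0) -normrM mulrBl scaleVK //.
  rewrite distrC; have := Hr (h + t); rewrite addrK [h * a]mulrC; apply.
  by near: h; apply/nbhs_ballP; exists r => // h; rewrite /ball /= sub0r normrN.
move: du; rewrite /derivable => /cvgrPdist_le /(_ _ e0).
have -> : lim ((fun h : R => h^-1 *: ((u \o shift t) (h *: 1) - u t)) @ 0^') = a.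
  by rewrite -da derive1E.
rewrite near_withinE => /nbhs_ballP[r /= r0 Hr]; exists r => // x xt.
have [->|xNt] := eqVneq x t; first by rewrite !subrr mul0r subrr normr0 mulr0.
have xt0 : x - t != 0 by rewrite subr_eq0.
have := Hr (x - t); rewrite /ball /= sub0r normrN => /(_ xt xt0).
rewrite [_ *: 1]mulr1 subrK -(ler_pM2r (_ : 0 < `|x - t|)) ?normr_gt0 // -normrM.
rewrite mulrBl scaleVK //=.
by rewrite distrC mulrC.
Unshelve. all: by end_near.
Qed.

(** The derivative in the real variable as one estimate on the modulus, to which the bounds on
    inverse branches apply directly; [curve_approxP] translates it to components. *)
Definition curve_approx (gamma : R -> R[i]) t (d : R[i]) := forall e, 0 < e ->
  exists2 r, 0 < r & forall x, `|x - t| < r ->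
    normc (gamma x - gamma t - (x - t)%:C * d) <= e * `|x - t|.

Lemma curve_approxP (gamma : R -> Cplx R) t d :
  curve_approx gamma t d <-> curve_derivable gamma t /\ curve_derive gamma t = d.
Proof.
pose rho x : R[i] := gamma x - gamma t - (x - t)%:C * d.
have ReE x : complex.Re (rho x) =
    complex.Re (gamma x) - complex.Re (gamma t) - (x - t) * complex.Re d.
  by rewrite /rho; case: (gamma x) (gamma t) (d) => [? ?] [? ?] [? ?] /=; ring.
have ImE x : complex.Im (rho x) =
    complex.Im (gamma x) - complex.Im (gamma t) - (x - t) * complex.Im d.
  by rewrite /rho; case: (gamma x) (gamma t) (d) => [? ?] [? ?] [? ?] /=; ring.
split=> [H|[[dR dI] dE]].
  have [dR dRE] : derivable (fun s => complex.Re (gamma s)) t 1 /\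
      derive1 (fun s => complex.Re (gamma s)) t = complex.Re d.
    apply/linear_approxP => e e0; have [r r0 Hr] := H e e0; exists r => // x xt.
    by rewrite -ReE; apply: (le_trans (Re_normc _)); apply: Hr.
  have [dI dIE] : derivable (fun s => complex.Im (gamma s)) t 1 /\
      derive1 (fun s => complex.Im (gamma s)) t = complex.Im d.
    apply/linear_approxP => e e0; have [r r0 Hr] := H e e0; exists r => // x xt.
    by rewrite -ImE; apply: (le_trans (Im_normc _)); apply: Hr.
  by split=> //; rewrite /curve_derive dRE dIE; case: (d).
have HR : linear_approx (fun s => complex.Re (gamma s)) t (complex.Re d).
  by apply/linear_approxP; rewrite -dE.
have HI : linear_approx (fun s => complex.Im (gamma s)) t (complex.Im d).
  by apply/linear_approxP; rewrite -dE.
move=> e e0; have e20 : 0 < e / 2 by rewrite divr_gt0.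
have [r r0 Hr] := HR _ e20; have [r' r'0 Hr'] := HI _ e20.
exists (Num.min r r') => [|x]; first by rewrite lt_min r0.
rewrite lt_min => /andP[/Hr + /Hr']; rewrite -ReE -ImE -/(rho x) => H1 H2.
have := normc_ReIm (rho x); lra.
Qed.

End Curves.

(** * Curves with a pointwise bound on the Kobayashi metric *)

Section Linked.
Variable R : realType.
Implicit Types (z w q d xi : R[i]) (U : set R[i]) (t a b e M : R) (gamma G : R -> R[i]).

Lemma within_itv_normcP a b gamma :
  {within `[a, b], continuous (gamma : R -> Cplx R)} <->
  forall t, t \in `[a, b] -> forall e, 0 < e -> exists2 r, 0 < r &
    forall x, x \in `[a, b] -> `|x - t| < r -> normc (gamma x - gamma t) < e.
Proof.
split=> [/subspace_continuousP H t tab e e0|H].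
  have /(_ _)/= := H t tab [set w | normc (w - gamma t) < e].
  rewrite /nbhs /= => /(_ _)[|r /= r0 Hr]; first by apply/nbhs_normcP; exists e.
  by exists r => // x xab xt; apply: (Hr x) => //=; rewrite distrC.
apply/subspace_continuousP => t /= tab A /nbhs_normcP[e e0 eA].
have [r r0 Hr] := H t tab e e0.
apply/nbhs_ballP; exists r => // x; rewrite /ball /= distrC => xt xab.
by apply: eA; apply: Hr.
Qed.

Definition curve_continuous_at gamma t := forall e, 0 < e -> exists2 r, 0 < r &
    forall x, `|x - t| < r -> normc (gamma x - gamma t) < e.

Lemma curve_approx_continuous gamma t d :
  curve_approx gamma t d -> curve_continuous_at gamma t.
Proof.
move=> H e e0; have [r r0 Hr] := H 1 ltr01.
pose k := 1 + normc d.
have k0 : 0 < k by rewrite ltr_pwDl // normc_ge0.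
exists (Num.min r (e / k)) => [|x]; first by rewrite lt_min r0 divr_gt0.
rewrite lt_min => /andP[/Hr xr]; rewrite ltr_pdivlMr // => xe.
apply: le_lt_trans xe; rewrite mulrDr mulr1.
have := le_normcD (gamma x - gamma t - (x - t)%:C * d) ((x - t)%:C * d).
rewrite subrK normcM normcC; lra.
Qed.

Lemma curve_approx_rescale gamma G t (c : R) d :
  curve_approx G (2 * t + c) d ->
  (exists2 r, 0 < r & forall x, `|x - t| < r -> gamma x = G (2 * x + c)) ->
  curve_approx gamma t (2%:C * d).
Proof.
move=> HG [r r0 Hr] e e0; have [r' r'0 Hr'] := HG (e / 2) (divr_gt0 e0 (ltr0n _ 2)).
exists (Num.min r (r' / 2)) => [|x]; first by rewrite lt_min r0 divr_gt0.
rewrite lt_min => /andP[xr xr'].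
have E : 2 * x + c - (2 * t + c) = 2 * (x - t) by ring.
have xt2 : `|2 * (x - t)| = 2 * `|x - t| by rewrite normrM (ger0_norm (ler0n R 2)).
have := Hr' (2 * x + c); rewrite E xt2 => /(_ ltac:(lra)).
rewrite Hr // Hr ?subrr ?normr0 //.
have -> : (x - t)%:C * (2%:C * d) = (2 * (x - t))%:C * d.
  by rewrite rmorphM /= mulrCA mulrA.
by have -> : e * `|x - t| = e / 2 * (2 * `|x - t|) by lra.
Qed.

(** Says that a positive [M] competes in the infimum defining [kobayashi_metric]. *)
Definition disc_bound U M z xi := exists h : Cplx R -> Cplx R,
  [/\ holomorphic_on (@unit_disk R) h, (forall w, unit_disk w -> U (h w)),
      h 0 = z & M%:C * derive1 h 0 = xi].

Lemma disc_bound_double U M z xi :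
  disc_bound U M z xi -> disc_bound U (2 * M) z (2%:C * xi).
Proof. by move=> [h [h1 h2 h3 <-]]; exists h; split=> //; rewrite rmorphM /= mulrA. Qed.

Lemma disc_bound_metric U M z xi :
  0 < M -> disc_bound U M z xi -> (kobayashi_metric U z xi <= M%:E)%E.
Proof. by move=> M0 hM; apply: ereal_inf_lbound; exists M. Qed.

Lemma kobayashi_metric_ge0 U z xi : (0 <= kobayashi_metric U z xi)%E.
Proof. by apply: le_ereal_inf_tmp => _ [l [l0 _] <-]; rewrite lee_fin ltW. Qed.

(** The parameter interval has length 1, so the pointwise bound [M] off the breakpoints also bounds
    the length. Keeping the disks themselves as witnesses lets curves be concatenated without any
    integration. *)
Definition linked U M z q := exists gamma (s : seq R),
  [/\ gamma 0 = z /\ gamma 1 = q,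
      {within `[0, 1], continuous (gamma : R -> Cplx R)},
      itv_partition 0 1 s,
      (forall i, (i < size s)%N ->
        smooth_on_itv gamma (nth 0 (0 :: s) i) (nth 0 (0 :: s) i.+1)) &
      forall t, t \in `[0, 1] -> U (gamma t) /\ (t \notin 0 :: s ->
        exists2 d, curve_approx gamma t d & disc_bound U M (gamma t) d)].

Lemma linked_dist U M z q : 0 < M -> linked U M z q ->
  (kobayashi_dist U z q <= M%:E)%E.
Proof.
move=> M0 [gamma [s [[g0 g1] gc sp sm H]]].
apply: (@le_trans _ _ (kobayashi_length U gamma)).
  apply: ereal_inf_lbound; exists gamma => //; split => //.
    by split=> //; exists s.
  by move=> t /H[].
apply: (@integral01_le _ _ _ (0 :: s)); first exact: ltW.
  by move=> t _; apply: kobayashi_metric_ge0.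
move=> t /H[_ Ht] /Ht[d /curve_approxP[_ ->]]; exact: disc_bound_metric.
Qed.

Lemma linked_refl U M z : 0 < M -> U z -> linked U M z z.
Proof.
move=> M0 Uz; have ca t : curve_approx (fun=> z) t 0.
  move=> e e0; exists 1 => // x _.
  by rewrite mulr0 subr0 subrr normc0 mulr_ge0 // ltW.
exists (fun=> z), [:: 1]; split => //.
- by apply: continuous_subspaceT => x; exact: cvg_cst.
- by apply: itv_partition1; exact: ltr01.
- case=> //= _; exists (fun=> 0); split.
    by apply: continuous_subspaceT => x; exact: cvg_cst.
  by move=> t _; apply/curve_approxP.
move=> t _; split=> // _; exists 0 => //; exists (fun=> z).
have H (x : R[i]) : qderiv (fun=> z) x 0.
  exists 0, 1; split=> // w _.
  by rewrite mul0r subr0 subrr normc0 mul0r.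
by split=> //; have [_ ->] := qderivP (H 0); rewrite mulr0.
Qed.

(* Both pieces of the concatenated curve run at double speed, which doubles M. *)
Lemma linked_cons U M z' z q G v : G 0 = z' -> G 1 = z ->
  (forall t, t \in `[0, 1] -> [/\ U (G t), curve_approx G t (v t),
     curve_continuous_at v t & disc_bound U M (G t) (v t)]) ->
  linked U M z q -> linked U (2 * M) z' q.
Proof.
move=> G0 G1 HG [g [s [[g0 g1] /within_itv_normcP gc sp sm H]]].
(* [phi] carries the breakpoints of [g] into the second half of the interval; the old initial
   breakpoint 0 becomes the junction [1 / 2]. *)
pose phi (x : R) : R := (1 + x) / 2.
pose h t : R[i] := if t <= 1 / 2 then G (2 * t + 0) else g (2 * t + -1).
have hL t : t <= 1 / 2 -> h t = G (2 * t + 0) by rewrite /h => ->.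
have hR t : 1 / 2 <= t -> h t = g (2 * t + -1).
  rewrite le_eqVlt => /predU1P[<-|t2]; last by rewrite /h leNgt t2.
  rewrite /h lexx; have -> : 2 * (1 / 2) + 0 = 1 :> R by lra.
  by have -> : 2 * (1 / 2) + -1 = 0 :> R; [lra | rewrite G1 g0].
have dL t : 0 <= t -> t < 1 / 2 -> curve_approx h t (2%:C * v (2 * t + 0)).
  move=> t0 t2; have [|_ Ha _ _] := HG (2 * t + 0); first by rewrite in_itv /=; lra.
  apply: (curve_approx_rescale Ha); exists (1 / 2 - t); first by lra.
  by move=> x; rewrite ltr_norml => xt; apply: hL; lra.
have dR t d : 1 / 2 < t -> curve_approx g (2 * t + -1) d -> curve_approx h t (2%:C * d).
  move=> t2 Ha; apply: (curve_approx_rescale Ha); exists (t - 1 / 2); first by lra.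
  by move=> x; rewrite ltr_norml => xt; apply: hR; lra.
have nthE i : (i < (size s).+1)%N ->
    nth 0 (0 :: (1 / 2 :: map phi s)) i.+1 = phi (nth 0 (0 :: s) i).
  case: i => [|i] /=; first by rewrite /phi addr0.
  by rewrite ltnS => i_s; rewrite (nth_map 0).
exists h, (1 / 2 :: map phi s); split.
- split.
    have h0 : 0 <= 1 / 2 :> R by lra.
    by rewrite hL // mulr0 addr0.
  rewrite hR; last by lra.
  by have -> : 2 * 1 + -1 = 1 :> R by lra.
- apply/within_itv_normcP => t; rewrite in_itv /= => t01 e e0.
  have [r1 r10 H1] : exists2 r, 0 < r & forall x, x \in `[0, 1] -> x <= 1 / 2 ->
      `|x - t| < r -> normc (h x - h t) < e.
    have [t2|t2] := leP t (1 / 2); last first.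
      exists (t - 1 / 2); first by lra.
      by move=> x _ x2; rewrite ltr_norml => xt; exfalso; clear -t2 x2 xt; lra.
    have [|_ /curve_approx_continuous Hc _ _] := HG (2 * t + 0); first by rewrite in_itv /=; lra.
    have [r r0 Hr] := Hc e e0; exists (r / 2); first by lra.
    move=> x _ x2; rewrite ltr_norml => xt; rewrite !hL //; apply: Hr.
    by rewrite ltr_norml; lra.
  have [r2 r20 H2] : exists2 r, 0 < r & forall x, x \in `[0, 1] -> 1 / 2 <= x ->
      `|x - t| < r -> normc (h x - h t) < e.
    have [t2|t2] := leP (1 / 2) t; last first.
      exists (1 / 2 - t); first by lra.
      by move=> x _ x2; rewrite ltr_norml => xt; exfalso; clear -t2 x2 xt; lra.
    have [|r r0 Hr] := gc (2 * t + -1) _ e e0; first by rewrite in_itv /=; lra.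
    exists (r / 2); first by lra.
    move=> x; rewrite in_itv /= => x01 x2; rewrite ltr_norml => xt; rewrite !hR //; apply: Hr.
      by rewrite in_itv /=; lra.
    by rewrite ltr_norml; lra.
  exists (Num.min r1 r2) => [|x x01]; first by rewrite lt_min r10.
  rewrite lt_min => /andP[xr1 xr2]; have [x2|x2] := leP x (1 / 2); first exact: H1.
  by apply: H2 => //; exact: ltW.
- case: sp => sp sl; split => /=; last first.
    have -> : 1 / 2 = phi 0 by rewrite /phi addr0.
    by rewrite last_map (eqP sl) /phi -(natrD _ 1 1) divff // pnatr_eq0.
  apply/andP; split; first by lra.
  have -> : 1 / 2 = phi 0 by rewrite /phi addr0.
  rewrite path_map; apply: sub_path sp => x y /=; rewrite /phi => xy.
  by rewrite ltr_pM2r ?invr_gt0 // ltrD2l.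
- rewrite /= size_map => -[_|i i_s].
    exists (fun t => 2%:C * v (2 * t + 0)); split; last first.
      by move=> t; rewrite in_itv /= => t0; apply/curve_approxP; apply: dL; lra.
    apply/within_itv_normcP => t; rewrite in_itv /= => t0 e e0.
    have [|_ _ Hc _] := HG (2 * t + 0); first by rewrite in_itv /=; lra.
    have [|r r0 Hr] := Hc (e / 2); first by lra.
    exists (r / 2); first by lra.
    move=> x _; rewrite ltr_norml => xt; rewrite -mulrBr normcM normcC ger0_norm //.
    have := Hr (2 * x + 0); rewrite ltr_norml => /(_ ltac:(lra)); lra.
  rewrite -[smooth_on_itv _ _ _]/(smooth_on_itv h (nth 0 (0 :: (1 / 2 :: map phi s)) i.+1)
    (nth 0 (0 :: (1 / 2 :: map phi s)) i.+2)).
  rewrite !nthE //; last exact: ltnW.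
  have {sm} := sm i i_s; set a := nth 0 _ i; set b := nth 0 _ i.+1 => -[u [uc ud]].
  have a0 : 0 <= a.
    have := itv_partition_nth_ge (ltnW i_s) sp.
    by rewrite (set_nth_default 0) //=; exact: ltnW.
  exists (fun t => 2%:C * u (2 * t + -1)); split; last first.
    move=> t; rewrite in_itv /= /phi => tab.
    have /curve_approxP Ha : curve_derivable g (2 * t + -1) /\
        curve_derive g (2 * t + -1) = u (2 * t + -1).
      by apply: ud; rewrite in_itv /=; lra.
    by apply/curve_approxP; apply: dR => //; lra.
  move/within_itv_normcP in uc.
  apply/within_itv_normcP => t; rewrite in_itv /= /phi => t0 e e0.
  have [||r r0 Hr] := uc (2 * t + -1) _ (e / 2); first by rewrite in_itv /=; lra.
    by lra.
  exists (r / 2); first by lra.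
  move=> x; rewrite in_itv /= => xab; rewrite ltr_norml => xt.
  rewrite -mulrBr normcM normcC ger0_norm //.
  have := Hr (2 * x + -1); rewrite ltr_norml in_itv /= => /(_ ltac:(lra) ltac:(lra)); lra.
move=> t; rewrite in_itv /= => t01.
have [t2|t2] := leP t (1 / 2).
  have [|Ug _ _ Hb] := HG (2 * t + 0); first by rewrite in_itv /=; lra.
  rewrite hL //; split=> //; rewrite !inE !negb_or => /and3P[_ t12 _].
  exists (2%:C * v (2 * t + 0)); last exact: disc_bound_double.
  by apply: dL; rewrite ?lt_neqAle ?t12 //; lra.
have [|Ug Hg] := H (2 * t + -1); first by rewrite in_itv /=; lra.
rewrite (hR t (ltW t2)); split=> //; rewrite !inE !negb_or => /and3P[t0 t12 ts].
have [|d da db] := Hg; last first.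
  by exists (2%:C * d); [exact: dR | exact: disc_bound_double].
rewrite inE negb_or; apply/andP; split; first by apply/eqP; lra.
apply: contra ts => ts; apply/mapP; exists (2 * t + -1) => //.
by rewrite /phi; lra.
Qed.

End Linked.

(** * Lifting one step of a chain through a polynomial *)

Section Lifting.
Variable R : realType.
Implicit Types (z w q d xi : R[i]) (U : set R[i]) (t a b e M : R) (gamma G : R -> R[i]).

(** The only property of the component [U] that lifting uses: a curve inside [A] cannot leave
    [U]. *)
Definition path_closed (A : set R[i]) U := forall gamma,
  (forall t, t \in `[0, 1] -> curve_continuous_at gamma t) ->
  (forall t, t \in `[0, 1] -> A (gamma t)) -> U (gamma 0) -> U (gamma 1).

(** The branch [g] with [g w' = z'] carries the segment from [w'] to [w] to a curve from [z'] to
    [z], and carries disks around points of the segment to disks in [U]. The factor 2 does not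
    depend on [F] or [r], which makes the estimate uniform over iterates. *)
Lemma linked_lift (F : {poly R[i]}) U w w' z' r M : (1 < size F)%N ->
  (forall y, F^`().[y] = 0 -> r <= normc (F.[y] - w')) ->
  path_closed [set y | normc (F.[y] - w') < r] U ->
  F.[z'] = w' -> U z' -> 4 * normc (w - w') < r -> 1 <= M ->
  exists z, [/\ F.[z] = w, U z & forall q, linked U M z q -> linked U (2 * M) z' q].
Proof.
move=> sF crit pU Fz' Uz' wr M1.
set D := normc (w - w') in wr *; have D0 : 0 <= D by exact: normc_ge0.
have r0 : 0 < r by lra.
(* Points up to distance [3 * D] from [w'] are used below, and [4 * D < r] gives [3 * D < r']. *)
pose r' := 3 / 4 * r; have r'0 : 0 < r' by rewrite /r'; lra.
have r'r : r' < r by rewrite /r'; lra.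
have [g [dg [K [delta [delta0 K0 gw' Fg H]]]]] := inverse_branch sF r'0 r'r crit Fz'.
have small e B : 0 < e -> 0 <= B -> exists2 k, 0 < k & forall x, 0 <= x -> x < k -> x * B < e.
  move=> e0 B0; exists (e / (B + 1)); first by rewrite divr_gt0 // ltr_wpDl.
  by move=> x x0; rewrite ltr_pdivlMr ?ltr_wpDl // mulrDr mulr1; lra.
have line (x b : R[i]) (k t : R) : 0 < k ->
    (forall s, `|s - t| < k -> normc (x + s%:C * b - w') < r') ->
    curve_approx (fun s => g (x + s%:C * b)) t (dg (x + t%:C * b) * b) /\
    curve_continuous_at (fun s => dg (x + s%:C * b) * b) t.
  move=> k0 Hk; have B0 := normc_ge0 b.
  have tt : normc (x + t%:C * b - w') < r' by apply: Hk; rewrite subrr normr0.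
  have E s : x + s%:C * b - (x + t%:C * b) = (s - t)%:C * b.
    by rewrite rmorphB /=; ring.
  have [k1 k10 Hk1] := small _ _ delta0 B0.
  split=> e e0.
    have [k2 k20 Hk2] := small e (K * normc b ^+ 2) e0 ltac:(by rewrite mulr_ge0 ?exprn_ge0 // ltW).
    exists (Num.min k (Num.min k1 k2)) => [|s]; first by rewrite !lt_min k0 k10.
    rewrite !lt_min => /and3P[sk sk1 sk2].
    have [|+ _ _] := H _ _ tt (Hk s sk).
      by rewrite E normcM normcC Hk1.
    rewrite E normcM normcC => Hg.
    have -> : (s - t)%:C * (dg (x + t%:C * b) * b) = dg (x + t%:C * b) * ((s - t)%:C * b) by ring.
    apply: (le_trans Hg); have := Hk2 _ (normr_ge0 (s - t)) sk2.
    have := normr_ge0 (s - t); rewrite exprMn expr2; nra.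
  have [k2 k20 Hk2] := small e (K * normc b ^+ 2) e0 ltac:(by rewrite mulr_ge0 ?exprn_ge0 // ltW).
  exists (Num.min k (Num.min k1 k2)) => [|s]; first by rewrite !lt_min k0 k10.
  rewrite !lt_min => /and3P[sk sk1 sk2].
  have [|_ + _] := H _ _ tt (Hk s sk).
    by rewrite E normcM normcC Hk1.
  rewrite E normcM normcC => Hg; rewrite -mulrBl normcM.
  have := Hk2 _ (normr_ge0 (s - t)) sk2; apply: le_lt_trans.
  apply: (@le_trans _ _ (K * (`|s - t| * normc b) * normc b)); first by rewrite ler_wpM2r.
  by rewrite le_eqVlt; apply/orP; left; apply/eqP; ring.
(* The lift of the segment from [w'] to [u] starts at [z'] in [U] and lies over the disk, so
   [path_closed] keeps its endpoint in [U]. *)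
have Ug u : normc (u - w') <= 2 * D -> U (g u).
  move=> uD.
  have E s : w' + s%:C * (u - w') - w' = s%:C * (u - w') by ring.
  (* The segment is prolonged beyond its ends because continuity at the parameters 0 and 1 is
     two-sided. *)
  have inr s : `|s| <= 3 / 2 -> normc (w' + s%:C * (u - w') - w') < r'.
    rewrite E normcM normcC => s2; rewrite /r'.
    have : `|s| * normc (u - w') <= 3 / 2 * (2 * D) by rewrite ler_pM ?normc_ge0.
    lra.
  have E0 : w' + 0%:C * (u - w') = w' by rewrite mul0r addr0.
  have E1 : w' + 1%:C * (u - w') = u by rewrite mul1r addrC subrK.
  have := pU (fun s => g (w' + s%:C * (u - w'))).
  rewrite E0 E1 gw'; apply => // t; rewrite in_itv /= => t01.
    have [|k|Ha _] := line w' (u - w') (1 / 2) t; first by lra.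
      rewrite ltr_norml => kt; apply: inr; rewrite ler_norml; lra.
    exact: curve_approx_continuous Ha.
  rewrite Fg; last by apply: inr; rewrite ler_norml; lra.
  by apply: lt_trans r'r; apply: inr; rewrite ler_norml; lra.
pose sg t : R[i] := w' + t%:C * (w - w').
have sgD t : normc (sg t - w') = `|t| * D by rewrite /sg addrC addKr normcM normcC.
have wr' : normc (w - w') < r' by rewrite -/D /r'; lra.
exists (g w); split; first exact: Fg.
  by apply: Ug; rewrite -/D; lra.
move=> q; apply: (@linked_cons _ _ _ _ _ _ (fun t => g (sg t)) (fun t => dg (sg t) * (w - w'))).
- by rewrite /sg mul0r addr0.
- by rewrite /sg mul1r addrC subrK.
move=> t; rewrite in_itv /= => t01.
have nt1 : `|t| <= 1 by rewrite ler_norml; lra.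
have tD : `|t| * D <= D by rewrite -[leRHS]mul1r ler_wpM2r.
have [|k|Ha Hc] := line w' (w - w') (1 / 2) t; first by lra.
  rewrite ltr_norml => kt; rewrite -/(sg k) sgD /r'.
  have : `|k| * D <= 3 / 2 * D by rewrite ler_wpM2r // ler_norml; lra.
  lra.
split=> //; first by apply: Ug; rewrite sgD; lra.
have M0 : 0 < M by lra.
(* The disk at [sg t] sends [zeta] to [g (sg t + zeta * k)]; [M] times its derivative at 0 is the
   velocity of the lifted segment. Since [M >= 1], its argument stays within [2 * D] of [w'], where
   [Ug] applies. *)
pose k : R[i] := (M^-1)%:C * (w - w').
have kD : normc k <= D.
  rewrite /k normcM normcC ger0_norm ?invr_ge0 ?(ltW M0) // -[leRHS]mul1r ler_wpM2r //.
  by rewrite invf_le1.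
have k0 := normc_ge0 k.
have uD zeta m : normc zeta <= m -> normc (sg t + zeta * k - w') <= (1 + m) * D.
  move=> zm; have -> : sg t + zeta * k - w' = (sg t - w') + zeta * k by ring.
  apply: (le_trans (le_normcD _ _)); rewrite sgD normcM.
  have : normc zeta * normc k <= m * D by rewrite ler_pM ?normc_ge0.
  lra.
have qd zeta : normc zeta < 1 ->
    qderiv (fun zeta => g (sg t + zeta * k)) zeta (dg (sg t + zeta * k) * k).
  move=> z1; have [k1 k10 Hk1] := small _ _ delta0 k0.
  exists (K * normc k ^+ 2), (Num.min 1 k1); split; first by rewrite lt_min ltr01.
  move=> eta; rewrite lt_min => /andP[e1 ek1].
  have E : sg t + eta * k - (sg t + zeta * k) = (eta - zeta) * k by ring.
  have eta2 : normc eta <= 2.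
    have := le_normcD (eta - zeta) zeta; rewrite subrK; lra.
  have [||| + _ _] := H (sg t + zeta * k) (sg t + eta * k).
  - by apply: le_lt_trans (uD _ _ (ltW z1)) _; rewrite /r'; lra.
  - by apply: le_lt_trans (uD _ _ eta2) _; rewrite /r'; lra.
  - by rewrite E normcM Hk1 ?normc_ge0.
  rewrite E normcM => Hg.
  have -> : K * normc k ^+ 2 * normc (eta - zeta) ^+ 2 =
    K * (normc (eta - zeta) * normc k) ^+ 2 by ring.
  by have -> : dg (sg t + zeta * k) * k * (eta - zeta) =
    dg (sg t + zeta * k) * ((eta - zeta) * k) by ring.
exists (fun zeta => g (sg t + zeta * k)); split.
- by move=> zeta; rewrite /unit_disk /= normE (ltcR _ 1) => /qd /qderivP[].
- move=> zeta; rewrite /unit_disk /= normE (ltcR _ 1) => /ltW z1; apply: Ug.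
  by have := uD _ _ z1; lra.
- by rewrite mul0r addr0.
have [|_ ->] := qderivP (qd 0 _); first by rewrite normc0.
rewrite mul0r addr0 /k mulrCA; congr (_ * _); rewrite mulrA -rmorphM /= divff ?mul1r //.
by rewrite gt_eqF.
Qed.

End Lifting.

(** * Connectedness, countable sets and compactness in the plane *)

Section Topology.
Variable R : realType.
Implicit Types (x y z w : R[i]) (t e r M : R).

(** The trace of [S] on [A] is cut out both by the open set [S1^°] and by the closed complement of
    [S0^°]. *)
Lemma connected_locally_constant (A S : set (Cplx R)) : connected A ->
  (forall x, A x -> exists2 r, 0 < r & forall y, A y -> normc (y - x) < r -> (S x <-> S y)) ->
  forall a b, A a -> A b -> S a -> S b.
Proof.
move=> cA loc a b Aa Ab Sa.
pose S1 : set (Cplx R) := [set y | A y -> S y]; pose S0 : set (Cplx R) := [set y | A y -> ~ S y].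
have SA : A `&` S = A `&` S1^°.
  apply/seteqP; split=> x [Ax].
    move=> Sx; split=> //; apply/nbhs_normcP; have [r r0 Hr] := loc x Ax.
    by exists r => // y yr Ay; apply/(Hr y).
  by move=> /nbhs_singleton /(_ Ax) Sx.
have SA0 : A `&` S = A `&` ~` S0^°.
  apply/seteqP; split=> x [Ax].
    by move=> Sx; split=> // /nbhs_singleton /(_ Ax).
  move=> nS; split=> //; apply: contrapT => nSx; apply: nS.
  apply/nbhs_normcP; have [r r0 Hr] := loc x Ax.
  by exists r => // y yr Ay /(Hr y Ay yr).
suff E : A `&` S = A by move: Ab; rewrite -E => -[].
apply: cA; first by exists a.
  by exists S1^° => //; exact: open_interior.
by exists (~` S0^°) => //; apply: open_closedC; exact: open_interior.
Qed.

Lemma path_connected_image (gamma : R -> Cplx R) :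
  (forall t, t \in `[0, 1] -> curve_continuous_at gamma t) ->
  connected (gamma @` `[0, 1]).
Proof.
move=> H; apply: connected_continuous_connected; first exact: segment_connected.
apply/within_itv_normcP => t /H Ht e /Ht[r r0 Hr].
by exists r => // x _ /Hr.
Qed.

Lemma segment_continuous a b t : curve_continuous_at (fun s => a + s%:C * (b - a) : R[i]) t.
Proof.
move=> e e0; exists (e / (normc (b - a) + 1)).
  by rewrite divr_gt0 // ltr_wpDl ?normc_ge0.
move=> s; rewrite ltr_pdivlMr ?ltr_wpDl ?normc_ge0 //; apply: le_lt_trans.
have -> : a + s%:C * (b - a) - (a + t%:C * (b - a)) = (s - t)%:C * (b - a).
  by rewrite rmorphB /=; ring.
by rewrite normcM normcC mulrDr mulr1 lerDl.
Qed.

Lemma segment_in_ball c a b r t : t \in `[0, 1] -> normc (a - c) < r ->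
  normc (b - c) < r -> normc (a + t%:C * (b - a) - c : R[i]) < r.
Proof.
rewrite in_itv /= => t01 ar br.
have -> : a + t%:C * (b - a) - c = (1 - t)%:C * (a - c) + t%:C * (b - c).
  by rewrite rmorphB rmorph1 /=; ring.
apply: (le_lt_trans (le_normcD _ _)); rewrite !normcM !normcC !ger0_norm; [|lra|lra].
have [->|t0] := eqVneq t 0; first by rewrite subr0 mul1r mul0r addr0.
have tr : t * normc (b - c) < t * r by rewrite ltr_pM2l // lt_neqAle eq_sym t0; lra.
have : (1 - t) * normc (a - c) <= (1 - t) * r by apply: ler_wpM2l; [lra|exact: ltW].
lra.
Qed.

Lemma countable_setU (T : Type) (A B : set T) :
  countable A -> countable B -> countable (A `|` B).
Proof.
move=> cA cB; have -> : A `|` B = \bigcup_(b : bool) (if b then A else B).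
  apply/seteqP; split=> x; first by case=> ?; [exists true | exists false].
  by case=> -[] _ ?; [left | right].
by apply: bigcup_countable => [|[]] //; exact: countableP.
Qed.

(** A countable set is Lebesgue null, whereas the interval has measure [e]. *)
Lemma countable_avoid (A : set R) e : countable A -> 0 < e ->
  exists2 t, 0 < t < e & ~ A t.
Proof.
move=> cA e0; apply: contrapT => H.
have : lebesgue_measure `]0%R, e[%classic = 0%E.
  apply: countable_lebesgue_measure0; apply: sub_countable cA; apply: subset_card_le.
  move=> t /=; rewrite in_itv /= => t0; apply: contrapT => At; apply: H.
  by exists t.
by rewrite lebesgue_measure_itv /= lte_fin e0 sube0 => -[] /eqP; rewrite gt_eqF.
Qed.

(** Bolzano-Weierstrass, transported from a compact square in [R * R]. *)
Lemma bounded_seq_cluster (u : nat -> R[i]) M : (forall n, normc (u n) <= M) ->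
  exists l, forall e N, 0 < e -> exists2 n, (N <= n)%N & normc (u n - l) < e.
Proof.
move=> uM.
pose v n : R * R := (complex.Re (u n), complex.Im (u n)).
have cK : compact (`[- M, M]%classic `*` `[- M, M]%classic : set (R * R)).
  by apply: compact_setX; exact: segment_compact.
have [|[x y] [_ vl]] := cK (v @ \oo) _.
  exists 0%N => // n _; split; rewrite /= in_itv /= -ler_norml;
    by [exact: le_trans (Re_normc _) (uM n) | exact: le_trans (Im_normc _) (uM n)].
exists (x +i* y) => e N e0.
have e20 : 0 < e / 2 by rewrite divr_gt0.
have [||p [[n /= Nn <-] [/= b1 b2]]] :=
  vl [set v n | n in [set n | (N <= n)%N]] (ball (x, y) (e / 2)).
- by exists N => // n Nn; exists n.
- exact: nbhsx_ballx.
exists n => //; apply: (le_lt_trans (normc_ReIm _)).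
move: b1 b2; rewrite /ball /= distrC [`|y - _|]distrC /v; case: (u n) => p1 p2 /=.
lra.
Qed.

(** * Chains of disks avoiding a countable set *)

Section Chain.
Variables (Om E : set (Cplx R)) (P : nat -> R[i] -> Prop) (q : R[i]).
Hypothesis conn : connected Om.
Hypothesis openO : forall z, Om z -> exists2 r, 0 < r & forall w, normc (w - z) < r -> Om w.
Hypothesis countE : countable E.
Hypothesis openE : forall z, Om z -> ~ E z ->
  exists2 r, 0 < r & forall w, normc (w - z) < r -> ~ E w.
(** [P n w] stands for a property of [w] established by a chain of [n] disks from [q]. The disk free
    of [E] is centred at the new point [w']. *)
Hypothesis step : forall n w w' r, (forall x, normc (x - w') < r -> Om x /\ ~ E x) ->
  4 * normc (w - w') < r -> P n w -> P n.+1 w'.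
Hypothesis Oq : Om q.
Hypothesis Eq : ~ E q.
Hypothesis Pq : P 0%N q.

Let openU z : Om z -> ~ E z ->
  exists2 r, 0 < r & forall w, normc (w - z) < r -> Om w /\ ~ E w.
Proof.
move=> Oz Ez; have [r r0 Hr] := openO Oz; have [r' r'0 Hr'] := openE Oz Ez.
exists (Num.min r r'); first by rewrite lt_min r0.
by move=> w; rewrite lt_min => /andP[/Hr + /Hr'].
Qed.

(** The factor 8 makes the step usable in both directions: the disk of radius [r / 2] around [w]
    lies in the one around [z]. *)
Let step_near z w r n : (forall x, normc (x - z) < r -> Om x /\ ~ E x) ->
  8 * normc (w - z) < r -> (P n z -> P n.+1 w) /\ (P n w -> P n.+1 z).
Proof.
move=> zU wz; have wz0 := normc_ge0 (w - z); split.
  apply: (@step n z w (r / 2)); last by rewrite normc_distC; lra.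
  by move=> x xw; apply: zU; have := normc_tri x w z; lra.
by apply: (@step n w z r) => //; lra.
Qed.

Let S w := exists n, P n w.

Let S_locconst z : Om z -> ~ E z -> exists2 r, 0 < r & forall w, normc (w - z) < r -> (S z <-> S w).
Proof.
move=> Oz Ez; have [r r0 Hr] := openU Oz Ez; exists (r / 8); first by lra.
move=> w wr; have wr8 : 8 * normc (w - z) < r by lra.
by split=> -[n Pn]; exists n.+1; have [] := step_near n Hr wr8; auto.
Qed.

Let S_segment a b : (forall t, t \in `[0, 1] ->
    Om (a + t%:C * (b - a)) /\ ~ E (a + t%:C * (b - a))) -> S a -> S b.
Proof.
move=> H; pose sg s : Cplx R := a + s%:C * (b - a).
have c : connected (sg @` `[0, 1]).
  by apply: path_connected_image => t _; exact: segment_continuous.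
have sga : sg 0 = a by rewrite /sg mul0r addr0.
have sgb : sg 1 = b by rewrite /sg mul1r addrC subrK.
apply: (connected_locally_constant c).
- move=> _ [t t01 <-]; have [Ot Et] := H t t01.
  by have [r r0 Hr] := S_locconst Ot Et; exists r => // y _ /Hr.
- by exists 0 => //=; rewrite in_itv /= lexx ler01.
- by exists 1 => //=; rewrite in_itv /= lexx ler01.
Qed.

(* The points m_t = (a+b)/2 + i t (b-a) give pairwise disjoint broken lines from
   a to b, so only countably many of them meet E. *)
Let S_ball c r a b : (forall x, normc (x - c) < r -> Om x) ->
  normc (a - c) < r -> normc (b - c) < r -> ~ E a -> ~ E b -> S a -> S b.
Proof.
move=> cO ar br Ea Eb Sa.
have [->//|ab] := eqVneq b a.
have ba0 : b - a != 0 by rewrite subr_eq0.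
have ab0 : a - b != 0 by rewrite subr_eq0 eq_sym.
have mr : normc ((a + b) / 2 - c) < r.
  have -> : (a + b) / 2 - c = a + ((1 / 2 : R)%:C) * (b - a) - c.
    by rewrite rmorphM fmorphV rmorph1 rmorphMn rmorph1 /=; field.
  by apply: segment_in_ball => //; rewrite in_itv /=; lra.
(* On the leg from [u], [k = s (1/2 + i t')], so [tau] recovers [t'] from any point with [s]
   nonzero. Seen from [b], the midpoint [m] has parameter [- t], whence the sign in [bad]. *)
pose tau (u v x : R[i]) : R := let k := (x - u) / (v - u) in complex.Im k / (2 * complex.Re k).
pose bad : set R := (tau a b @` E) `|` ((fun x => - tau b a x) @` E).
have cbad : countable bad.
  by apply: countable_setU; apply: (sub_countable (card_image_le _ _) countE).
(* For [t < e] the point [m] stays in the ball. *)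
pose e := (r - normc ((a + b) / 2 - c)) / normc (b - a).
have e0 : 0 < e by rewrite divr_gt0 ?normc_gt0 // subr_gt0.
have [t /andP[t0 te] tbad] := countable_avoid cbad e0.
pose m : R[i] := (a + b) / 2 + (0 +i* t) * (b - a).
have mc : normc (m - c) < r.
  have -> : m - c = ((a + b) / 2 - c) + (0 +i* t) * (b - a) by rewrite /m; ring.
  apply: (le_lt_trans (le_normcD _ _)); rewrite normcM.
  have -> : normc (0 +i* t) = t by rewrite /= expr0n add0r sqrtr_sqr ger0_norm // ltW.
  by move: te; rewrite /e ltr_pdivlMr ?normc_gt0 //; lra.
have E2 : (1 / 2 : R)%:C = (1 / 2 : R[i]).
  by rewrite rmorphM fmorphV rmorph1 rmorphMn rmorph1.
have key u v s (x : R[i]) (t' : R) : v - u != 0 -> s != 0 ->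
    x = u + s%:C * ((1 / 2 +i* t') * (v - u)) -> tau u v x = t'.
  move=> uv s0 xE; rewrite /tau; have -> : (x - u) / (v - u) = (s * (1 / 2)) +i* (s * t').
    rewrite xE addrC addKr mulrA mulfK //; apply/eqP; rewrite eq_complex /=.
    by rewrite !mul0r subr0 addr0 !eqxx.
  by rewrite /=; field.
have half : (1 / 2 +i* t) = 1 / 2 + (0 +i* t) :> R[i].
  by rewrite -E2; apply/eqP; rewrite eq_complex /= addr0 add0r !eqxx.
have halfN : (1 / 2 +i* (- t)) = 1 / 2 - (0 +i* t) :> R[i].
  by rewrite -E2; apply/eqP; rewrite eq_complex /= subr0 sub0r !eqxx.
have Sm : S m.
  apply: S_segment Sa => s s01; split; first by apply: cO; exact: segment_in_ball.
  have [->|s0] := eqVneq s 0; first by rewrite mul0r addr0.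
  move=> Ex; apply: tbad; left; exists (a + s%:C * (m - a)) => //.
  apply: (key _ _ s) => //; congr (_ + _ * _).
  by rewrite half /m; field.
apply: S_segment Sm => s s01; split; first by apply: cO; exact: segment_in_ball.
have [->|s1] := eqVneq s 1; first by rewrite mul1r addrC subrK.
move=> Ex; apply: tbad; right; exists (m + s%:C * (b - m)) => //.
rewrite -[RHS]opprK; congr (- _); apply: (key _ _ (1 - s)) => //.
  by rewrite subr_eq0 eq_sym.
by rewrite halfN rmorphB rmorph1 /m /=; field.
Qed.

Let U_dense z r : Om z -> 0 < r -> exists x, [/\ normc (x - z) < r, Om x & ~ E x].
Proof.
move=> Oz r0; have [r' r'0 Hr'] := openO Oz.
have [t /andP[t0]] : exists2 t, 0 < t < Num.min r r' & ~ [set complex.Re (x - z) | x in E] t.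
  apply: countable_avoid; first exact: (sub_countable (card_image_le _ _) countE).
  by rewrite lt_min r0.
rewrite lt_min => /andP[tr tr'] Et; exists (z + t%:C).
have zt : normc (z + t%:C - z) = t by rewrite addrC addKr normcC ger0_norm // ltW.
split; rewrite ?zt //; first by apply: Hr'; rewrite zt.
by move=> Ez; apply: Et; exists (z + t%:C) => //; rewrite addrC addKr.
Qed.

(** Connectedness is available for [Om], not for [Om] minus [E]. The property [T], that all nearby
    points off [E] satisfy [S], makes sense on [E] too, and is locally constant on [Om] by [S_ball]
    and the density of the complement of [E]. *)
Lemma chain_reach w : Om w -> ~ E w -> exists n, P n w.
Proof.
move=> Ow Ew.
pose T z := exists2 r, 0 < r & forall x, normc (x - z) < r -> Om x -> ~ E x -> S x.
have Tloc z : Om z -> exists2 r, 0 < r & forall y, Om y -> normc (y - z) < r -> (T z <-> T y).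
  move=> Oz; have [r r0 Hr] := openO Oz; exists r => // y Oy yr.
  have spread x : normc (x - z) < r -> ~ E x -> S x ->
      forall x', normc (x' - z) < r -> ~ E x' -> S x'.
    by move=> xr Ex Sx x' x'r Ex'; exact: S_ball Hr xr x'r Ex Ex' Sx.
  have zr : normc (z - z) < r by rewrite subrr normc0.
  have go u u' : Om u -> normc (u - z) < r -> normc (u' - z) < r -> T u -> T u'.
    move=> Ou ur u'r [d d0 Hd].
    have [|x [xu Ox Ex]] := @U_dense u (Num.min d (r - normc (u - z))) Ou.
      by rewrite lt_min d0 subr_gt0.
    move: xu; rewrite lt_min => /andP[xd xr].
    have Sx := Hd x xd Ox Ex.
    have xz : normc (x - z) < r by have := normc_tri x u z; lra.
    exists (r - normc (u' - z)); first by rewrite subr_gt0.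
    move=> x' x'u Ox' Ex'; apply: (spread x) => //.
    by have := normc_tri x' u' z; lra.
  by split; exact: go.
have Tq : T q.
  have [r r0 Hr] := S_locconst Oq Eq; exists r => // x xr _ _.
  by apply/(Hr x xr); exists 0%N.
have [r r0 Hr] : T w by exact: (connected_locally_constant conn Tloc Oq Ow Tq).
by apply: Hr => //; rewrite subrr normc0.
Qed.

(** Otherwise points [u n] of [K] failing [P n] accumulate at some [l] in [K] with [P m l]. One more
    step gives [P m.+1 (u n)] for some [n > m], and steps of length zero raise the index to [n], a
    contradiction. *)
Lemma chain_reach_uniform (K : set R[i]) M : (forall x, K x -> normc x <= M) ->
  (forall l, (forall e, 0 < e -> exists2 x, K x & normc (x - l) < e) -> K l) ->
  (forall x, K x -> Om x /\ ~ E x) ->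
  exists n, forall x, K x -> P n x.
Proof.
move=> KM Kcl KU; apply: contrapT => H.
have {H}/choice[u Hu] : forall n, exists x, K x /\ ~ P n x.
  move=> n; apply: contrapT => Hn; apply: H; exists n => x Kx.
  by apply: contrapT => nP; apply: Hn; exists x.
have [l Hl] := @bounded_seq_cluster u M (fun n => KM _ (Hu n).1).
have Kl : K l.
  by apply: Kcl => e /(Hl e 0%N)[n _ ul]; exists (u n) => //; have [] := Hu n.
have [Ol El] := KU l Kl.
have [m Pm] := chain_reach Ol El; have [r r0 Hr] := openU Ol El.
have mono n k x : K x -> P n x -> (n <= k)%N -> P k x.
  move=> /KU[Ox Ex] Pn; elim: k => [|k IH]; first by rewrite leqn0 => /eqP <-.
  rewrite leq_eqVlt => /predU1P[<-//|/IH Pk].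
  have [r' r'0 Hr'] := openU Ox Ex; apply: step Hr' _ Pk.
  by rewrite subrr normc0 mulr0.
have [|n mn un] := Hl (r / 8) m.+1; first by lra.
have [Kn nP] := Hu n; apply: nP; apply: mono mn => //.
have un8 : 8 * normc (u n - l) < r by lra.
by have [+ _] := step_near m Hr un8; apply.
Qed.

End Chain.
End Topology.

(** * Iterates as polynomials and their critical points *)

Section Iterates.
Variable R : realType.
Implicit Types (f F q : {poly R[i]}) (z w x y : R[i]) (e : R).

Definition iter_poly f k : {poly R[i]} := iter k (fun q => f \Po q) 'X.

Lemma horner_iter_poly f k z : (iter_poly f k).[z] = iter k (horner f) z.
Proof. by elim: k => [|k IH] /=; rewrite ?hornerX // horner_comp IH. Qed.

Lemma size_iter_poly f k : (1 < size f)%N -> (1 < size (iter_poly f k))%N.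
Proof.
move=> sf; elim: k => [|k IH]; first by rewrite size_polyX.
rewrite -subn_gt0 subn1 size_comp_poly muln_gt0.
by case: (size f) sf => [|[]] //; case: (size _) IH => [|[]].
Qed.

(** The chain rule along the orbit of [y]. *)
Lemma iter_poly_crit f k y : (iter_poly f k)^`().[y] = 0 ->
  exists2 j, (j < k)%N & f^`().[iter j (horner f) y] = 0.
Proof.
elim: k => [|k IH] /=; first by rewrite derivX hornerC => /eqP; rewrite oner_eq0.
rewrite deriv_comp hornerM horner_comp -/(iter_poly f k) horner_iter_poly.
move=> /eqP; rewrite mulf_eq0 => /orP[/eqP H|/eqP/IH[j jk H]]; first by exists k.
by exists j => //; exact: ltnW.
Qed.

Lemma horner_near F z e : 0 < e -> exists2 r, 0 < r &
  forall w, normc (w - z) < r -> normc (F.[w] - F.[z]) < e.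
Proof.
move=> e0; have [K K0 HK] := @poly_taylor2 R F (normc z + 1) (addr_ge0 (normc_ge0 z) ler01).
exists (Num.min 1 (e / K)) => [|w]; first by rewrite lt_min ltr01 divr_gt0.
rewrite lt_min ltr_pdivlMr // mulrC => /andP[w1]; apply: le_lt_trans.
have [||//] := HK w z; last by rewrite lerDl.
have := le_normcD (w - z) z; rewrite subrK; lra.
Qed.

Lemma finite_dist_pos (s : seq R[i]) x : exists2 r, 0 < r &
  forall y, y \in s -> y != x -> r <= normc (y - x).
Proof.
elim: s => [|a s [r r0 IH]]; first by exists 1.
have [->|ax] := eqVneq a x.
  by exists r => // y; rewrite inE => /predU1P[->|/IH//]; rewrite eqxx.
exists (Num.min r (normc (a - x))); first by rewrite lt_min r0 normc_gt0 subr_eq0.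
move=> y; rewrite inE ge_min => /predU1P[->|/IH H /H ->//].
by rewrite lexx orbT.
Qed.

Lemma derivative_roots f : (1 < size f)%N -> exists s : seq R[i],
  forall c, f^`().[c] = 0 -> c \in s.
Proof.
move=> sf; have [s sE] := closed_field_poly_normal f^`().
exists s => c /eqP; rewrite -[_ == 0]/(root _ c) sE rootZ ?root_prod_XsubC //.
by rewrite lead_coef_eq0 deriv_neq0.
Qed.

End Iterates.

(** * The immediate basin and the postcritical set *)

Section Attracting.
Variables (R : realType) (f : {poly R[i]}) (p : R[i]).
Hypothesis sf : (1 < size f)%N.
Hypothesis fp : attracting_fixed_point f p.
Implicit Types (z w x y c : R[i]) (e r : R).

Local Notation fn k z := (iter k (horner f) z).

Lemma iter_fixed k : fn k p = p.
Proof. by elim: k => //= k ->; case: fp. Qed.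

Lemma fnS k z : fn k f.[z] = fn k.+1 z.
Proof. by rewrite iterSr. Qed.

Lemma attracting_disk : exists2 r, 0 < r & exists2 a, 0 <= a < 1 &
  forall z, normc (z - p) < r -> normc (f.[z] - p) <= a * normc (z - p).
Proof.
have [fpp] := fp; rewrite normE (ltcR _ 1) => b1; set b := normc _ in b1.
have b0 : 0 <= b by exact: normc_ge0.
have [K K0 HK] := @poly_taylor2 R f (normc p + 1) (addr_ge0 (normc_ge0 p) ler01).
(* Within this radius the quadratic Taylor error is at most [(1 - b) / 2] times the distance to [p];
   adding the linear factor [b] gives [(1 + b) / 2]. *)
exists (Num.min 1 ((1 - b) / 2 / K)); first by rewrite lt_min ltr01 !divr_gt0 ?subr_gt0.
exists ((1 + b) / 2); first by lra.
move=> z; rewrite lt_min ltr_pdivlMr // => /andP[z1 zK].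
have [||_ H] := HK z p; [| |rewrite fpp in H].
- by have := le_normcD (z - p) p; rewrite subrK; lra.
- by rewrite lerDl.
have := le_normcD (f.[z] - p - f^`().[p] * (z - p)) (f^`().[p] * (z - p)).
rewrite subrK normcM -/b; have := normc_ge0 (z - p); nra.
Qed.

Lemma attracting_radius : exists2 r, 0 < r &
  (forall z, normc (z - p) < r -> basin f p z) /\
  (forall z s, s <= r -> normc (z - p) < s -> normc (f.[z] - p) < s).
Proof.
have [r r0 [a /andP[a0 a1] Ha]] := attracting_disk; exists r => //.
have inv z s : s <= r -> normc (z - p) < s -> normc (f.[z] - p) < s.
  move=> sr zs; apply: le_lt_trans (zs); apply: (le_trans (Ha _ _)).
    exact: lt_le_trans zs sr.
  by rewrite ler_piMl ?normc_ge0 // ltW.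
split=> // z zr; apply/cvg_normcP => e e0.
have H n : normc (fn n z - p) < r /\ normc (fn n z - p) <= a ^+ n * r.
  elim: n => [|n [IH1 IH2]] /=; first by rewrite expr0 mul1r ltW.
  split; first exact: inv.
  by rewrite exprS -mulrA (le_trans (Ha _ IH1)) // ler_wpM2l.
have : (fun n => a ^+ n : R) @ \oo --> (0 : R).
  by apply: cvg_expr; rewrite ger0_norm ?a1.
move=> /cvgrPdist_lt/(_ (e / r)) [|N _ HN]; first by rewrite divr_gt0.
exists N => n /HN; rewrite /= sub0r normrN ger0_norm ?exprn_ge0 //.
by rewrite ltr_pdivlMr //; apply: le_lt_trans; have [] := H n.
Qed.

Lemma basinP z : basin f p z <-> forall e, 0 < e ->
  exists N, forall n, (N <= n)%N -> normc (fn n z - p) < e.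
Proof. exact: cvg_normcP. Qed.

Lemma basin_iter k z : basin f p (fn k z) <-> basin f p z.
Proof.
split=> /basinP H; apply/basinP => e /H[N HN].
  exists (N + k)%N => n Nn; have -> : n = ((n - k) + k)%N.
    by rewrite subnK // (leq_trans _ Nn) // leq_addl.
  by rewrite iterD; apply: HN; rewrite leq_subRL ?(leq_trans _ Nn) ?leq_addl // addnC.
by exists N => n Nn; rewrite -iterD; apply: HN; rewrite (leq_trans Nn) // leq_addr.
Qed.

Lemma basin_open z : basin f p z -> exists2 r, 0 < r &
  forall w, normc (w - z) < r -> basin f p w.
Proof.
have [r0 r00 [Hr0 _]] := attracting_radius.
move=> /basinP/(_ r0 r00)[N /(_ N (leqnn N)) HN].
have [|r rr0 Hr] := @horner_near R (iter_poly f N) z (r0 - normc (fn N z - p)).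
  by rewrite subr_gt0.
exists r => // w /Hr; rewrite !horner_iter_poly => wz.
by apply/(basin_iter N); apply: Hr0; have := normc_tri (fn N w) (fn N z) p; lra.
Qed.

Lemma basin_fixed : basin f p p.
Proof. by apply/basinP => e e0; exists 0%N => n _; rewrite iter_fixed subrr normc0. Qed.

Let Om : set (Cplx R) := immediate_basin f p.

Lemma immediate_basin_sub z : Om z -> basin f p z.
Proof. exact: connected_component_sub. Qed.

Lemma immediate_basin_fixed : Om p.
Proof. by apply: connected_component_refl; exact: basin_fixed. Qed.

Lemma immediate_basin_connected : connected Om.
Proof. exact: component_connected. Qed.

Lemma immediate_basin_path : path_closed (basin f p) Om.
Proof.
move=> gamma gc gb g0; apply: connected_component_trans g0 _.
suff : (gamma @` `[0, 1] : set (Cplx R)) `<=` connected_component (basin f p) (gamma 0).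
  by apply; exists 1 => //=; rewrite in_itv /= lexx ler01.
apply: connected_component_max.
- by exists 0 => //=; rewrite in_itv /= lexx ler01.
- by move=> _ [t /gb ? <-].
exact: path_connected_image.
Qed.

Lemma immediate_basin_ball c r x y : (forall w, normc (w - c) < r -> basin f p w) ->
  normc (x - c) < r -> normc (y - c) < r -> Om x -> Om y.
Proof.
move=> cb xr yr Ox; have := @immediate_basin_path (fun s => x + s%:C * (y - x)).
have -> : x + 0%:C * (y - x) = x by rewrite mul0r addr0.
have -> : x + 1%:C * (y - x) = y by rewrite mul1r addrC subrK.
apply=> // t t01; first exact: segment_continuous.
by apply: cb; exact: segment_in_ball.
Qed.

Lemma immediate_basin_open z : Om z -> exists2 r, 0 < r &
  forall w, normc (w - z) < r -> Om w.
Proof.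
move=> Oz; have [r r0 Hr] := basin_open (immediate_basin_sub Oz).
exists r => // w wr; apply: (immediate_basin_ball Hr) Oz => //.
by rewrite subrr normc0.
Qed.

(** The image of [Om] is a connected subset of the basin containing [p]. *)
Lemma immediate_basin_image z : Om z -> Om f.[z].
Proof.
move=> Oz; suff : ((horner f : Cplx R -> Cplx R) @` Om) `<=` Om by apply; exists z.
apply: connected_component_max.
- by exists p; [exact: immediate_basin_fixed | case: fp].
- move=> _ [x /immediate_basin_sub xb <-].
  by rewrite -[f.[x]]/(fn 1 x); apply/basin_iter.
apply: connected_continuous_connected; first exact: immediate_basin_connected.
apply: (@continuous_subspaceT _ _ Om (horner f : Cplx R -> Cplx R)) => x A /nbhs_normcP[e e0 eA].
have [r r0 Hr] := @horner_near R f x e e0.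
by apply/nbhs_normcP; exists r => // w /Hr; exact: eA.
Qed.

Lemma immediate_basin_iter k z : Om z -> Om (fn k z).
Proof. by move=> Oz; elim: k => //= k; exact: immediate_basin_image. Qed.

(** Having a preimage in [Om] is locally constant on [Om]: nearby points have nearby preimages, and
    a small ball around a preimage lies in the basin, hence in a single component. *)
Lemma immediate_basin_surj w : Om w -> exists2 z, Om z & f.[z] = w.
Proof.
move=> Ow; pose S y := exists2 z, Om z & f.[z] = y.
apply: (@connected_locally_constant _ Om S immediate_basin_connected _ p w) => //; first last.
- by exists p; [exact: immediate_basin_fixed | case: fp].
- exact: immediate_basin_fixed.
move=> {Ow}{}w Ow; have [rho rho0 Hrho] := immediate_basin_open Ow.
have [M M0 HM] := poly_proper (normc w) sf.
have [L L0 HL] := @poly_taylor2 R f (M + 1) (addr_ge0 M0 ler01).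
(* Properness bounds all preimages of [w], so one Lipschitz constant [L] serves for all of them: the
   [e]-ball around each is mapped into the [rho]-ball around [w]. *)
pose e := Num.min 1 (rho / 2 / L).
have e0 : 0 < e by rewrite lt_min ltr01 !divr_gt0.
have ball y z : f.[z] = w -> normc (y - z) < e -> basin f p y.
  move=> fz; rewrite lt_min ltr_pdivlMr // => /andP[y1 yL].
  have zM : normc z <= M by apply: HM; rewrite fz.
  have [|| + _] := HL y z; [|by lra|].
    by have := le_normcD (y - z) z; rewrite subrK; lra.
  rewrite fz => fy; apply/(basin_iter 1); apply: immediate_basin_sub.
  by apply: Hrho => /=; lra.
have [d d0 Hd] := root_dist_radius sf e0; exists d => // y Oy yw; split=> -[z Oz fz].
  have [|zeta fzeta zz] := Hd z y; first by rewrite fz normc_distC.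
  exists zeta => //; apply: (@immediate_basin_ball z e z) => //.
  - by move=> x; exact: ball.
  - by rewrite subrr normc0.
  by rewrite normc_distC.
have [|zeta fzeta zz] := Hd z w; first by rewrite fz.
exists zeta => //; apply: (@immediate_basin_ball zeta e z) => //.
  by move=> x; exact: ball.
by rewrite subrr normc0.
Qed.

(** The orbits start at the critical values; they accumulate only at [p], whose inclusion makes the
    set closed. *)
Definition postcritical : set (Cplx R) :=
  [set x | x = p \/ exists c n, [/\ f^`().[c] = 0, basin f p c & x = fn n.+1 c]].

Lemma postcritical_countable : countable postcritical.
Proof.
have [s Hs] := derivative_roots sf.
pose g (k : nat * nat) : Cplx R := fn k.1.+1 (nth 0 s k.2).
have : countable ([set p] `|` (g @` [set: nat * nat])).
  apply: countable_setU; first exact: countable1.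
  by apply: (sub_countable (card_image_le _ _)); exact: countableP.
apply: sub_countable; apply: subset_card_le => x [->|[c [n [/Hs cs _ ->]]]]; first by left.
by right; exists (n, index c s) => //; rewrite /g /= nth_index.
Qed.

Lemma critical_tail e : 0 < e -> exists N, forall c, f^`().[c] = 0 -> basin f p c ->
  forall n, (N <= n)%N -> normc (fn n c - p) < e.
Proof.
move=> e0; have [s Hs] := derivative_roots sf.
suff [N HN] : exists N, forall c, c \in s -> basin f p c ->
    forall n, (N <= n)%N -> normc (fn n c - p) < e.
  by exists N => c /Hs; exact: HN.
elim: (s) => [|a l [N IH]]; first by exists 0%N.
have [/basinP/(_ e e0)[N' HN']|na] := pselect (basin f p a).
  exists (maxn N N') => c; rewrite inE => /predU1P[->|cl] cb n; rewrite geq_max => /andP[Nn N'n].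
    exact: HN'.
  exact: IH.
by exists N => c; rewrite inE => /predU1P[->//|cl]; exact: IH.
Qed.

(** From index [N] on, all critical orbits in the basin are closer to [p] than half the distance
    from [z] to [p]; only finitely many earlier points remain to be avoided. *)
Lemma postcritical_closed z : ~ postcritical z -> exists2 r, 0 < r &
  forall w, normc (w - z) < r -> ~ postcritical w.
Proof.
move=> nz; have zp : z != p by apply/eqP => zp; apply: nz; left.
pose e := normc (z - p) / 2.
have e0 : 0 < e by rewrite divr_gt0 // normc_gt0 subr_eq0.
have [N HN] := critical_tail e0; have [s Hs] := derivative_roots sf.
have [r r0 Hr] := finite_dist_pos [seq fn n.+1 c | c <- s, n <- iota 0 N] z.
exists (Num.min r e); first by rewrite lt_min r0.
move=> w; rewrite lt_min => /andP[wr we] [wp|[c [n [cc cb wE]]]].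
  by move: we; rewrite wp normc_distC /e; have := normc_ge0 (z - p); lra.
have [Nn|nN] := leqP N n.+1.
  have := HN c cc cb _ Nn; rewrite -wE => wpe.
  have := normc_tri z w p; rewrite (normc_distC z w).
  by move: we wpe; rewrite /e; lra.
have : r <= normc (w - z).
  apply: Hr; last by apply/eqP => wz; apply: nz; right; exists c, n; rewrite -wz.
  apply/allpairsP; exists (c, n); split=> //=; first exact: Hs.
  by rewrite mem_iota add0n /= ltnW.
by rewrite leNgt wr.
Qed.

(** Pull [q1] back [N] times inside [Om]. If the result were [fn n.+1 c], then [q1] would be the
    point of index [N + n.+1] on a critical orbit, too late to be so far from [p]. *)
Lemma generic_preimage q1 : Om q1 -> f.[q1] = p -> q1 != p ->
  exists q j, [/\ Om q, fn j q = p & ~ postcritical q].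
Proof.
move=> Oq1 fq1 q1p.
have /choice[s Hs] : forall w, exists z, Om w -> Om z /\ f.[z] = w.
  move=> w; have [/immediate_basin_surj[z Oz fz]|nO] := pselect (Om w); first by exists z.
  by exists w.
have Hx n : Om (iter n s q1) /\ fn n (iter n s q1) = q1.
  elim: n => [//|n [On En]]; have [Os fs] := Hs _ On.
  by split=> //; rewrite -fnS [iter n.+1 s q1]iterS fs.
have e0 : 0 < normc (q1 - p) by rewrite normc_gt0 subr_eq0.
have [N HN] := critical_tail e0; have [Ox fx] := Hx N.
exists (iter N s q1), N.+1; split => //; first by rewrite iterS fx.
move=> [xp|[c [n [cc cb xE]]]].
  by move/eqP: q1p; apply; rewrite -fx xp iter_fixed.
have := HN c cc cb (N + n.+1)%N (leq_addr _ _).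
by rewrite iterD -xE fx ltxx.
Qed.

(** * Reaching preimages of the fixed point uniformly in the iterate *)

Section Reach.
Variables (E : set (Cplx R)) (ks : set nat) (q : R[i]).
Hypothesis countE : countable E.
Hypothesis openE : forall z, ~ E z ->
  exists2 r, 0 < r & forall w, normc (w - z) < r -> ~ E w.
Hypothesis critE : forall k y, ks k -> (iter_poly f k)^`().[y] = 0 ->
  Om (fn k y) -> E (fn k y).
Hypothesis Oq : Om q.
Hypothesis Eq : ~ E q.
Hypothesis qp : exists j, fn j q = p.

(** Quantifying over all [k] in [ks] makes the bound independent of the iterate; the cost is
    [2 ^+ n] because every lifted step doubles it. *)
Definition reaches n w := forall k z, ks k -> Om z -> fn k z = w ->
  exists q, [/\ Om q, exists j, fn j q = p & linked Om (2 ^+ n) z q].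

(** [linked_lift] for the [k]-th iterate: by [critE] the disk contains no critical value, and a
    curve lying over a disk in [Om] stays in the basin. *)
Lemma reaches_step n w w' r : (forall x, normc (x - w') < r -> Om x /\ ~ E x) ->
  4 * normc (w - w') < r -> reaches n w -> reaches n.+1 w'.
Proof.
move=> Hr wr Pw k z' kk Oz' fz'; have M1 : 1 <= 2 ^+ n :> R by rewrite exprn_ege1 // ler1n.
have [|||z [fz Oz Hz]] := @linked_lift R (iter_poly f k) Om w w' z' r _
    (size_iter_poly k sf) _ _ _ Oz' wr M1.
- move=> y yc; rewrite leNgt horner_iter_poly; apply/negP => /Hr[Oy]; apply.
  exact: critE.
- move=> gamma gc gr; apply: immediate_basin_path => // t /gr /=.
  by rewrite horner_iter_poly => /Hr[/immediate_basin_sub /basin_iter].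
- by rewrite horner_iter_poly.
have [|q' [Oq' q'p /Hz]] := Pw k z kk Oz; first by rewrite -horner_iter_poly.
by exists q'; split=> //; rewrite exprS.
Qed.

Lemma reaches_start : reaches 0 q.
Proof.
move=> k z kk Oz fz; exists z; split=> //; last exact: linked_refl.
by have [j fj] := qp; exists (j + k)%N; rewrite iterD fz.
Qed.


Lemma reaches_uniform (K : set R[i]) M : (forall x, K x -> normc x <= M) ->
  (forall l, (forall e, 0 < e -> exists2 x, K x & normc (x - l) < e) -> K l) ->
  (forall x, K x -> Om x /\ ~ E x) ->
  exists n, forall x, K x -> reaches n x.
Proof.
apply: (chain_reach_uniform immediate_basin_connected immediate_basin_open countE
  _ reaches_step Oq Eq reaches_start).
by move=> z _; exact: openE.
Qed.

End Reach.

(** The two inequalities are closed conditions. A limit point [l] is in the basin because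
    [fn m.+1 l] is within [b] of [p]; a disk around [l] inside the basin meets [Om], hence lies in
    it. *)
Lemma fundamental_domain_closed m b b' l : (forall z, normc (z - p) <= b -> basin f p z) ->
  let K := [set w | [/\ Om w, normc (fn m.+1 w - p) <= b & b' <= normc (fn m w - p)]] in
  (forall e, 0 < e -> exists2 x, K x & normc (x - l) < e) -> K l.
Proof.
move=> Hb K Hl.
have lim n (c : R) : (forall x, K x -> normc (fn n x - p) <= c) ->
    normc (fn n l - p) <= c.
  move=> Hc; rewrite leNgt; apply/negP => cl.
  have [|r r0 Hr] := @horner_near R (iter_poly f n) l (normc (fn n l - p) - c).
    by rewrite subr_gt0.
  have [x Kx /Hr] := Hl r r0; rewrite !horner_iter_poly normc_distC.
  have := normc_tri (fn n l) (fn n x) p; have := Hc x Kx; lra.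
have lb : normc (fn m.+1 l - p) <= b by apply: lim => x [].
split=> //.
  have [|r r0 Hr] := @basin_open l; first by apply/(basin_iter m.+1); exact: Hb.
  have [x [Ox _ _] xl] := Hl r r0.
  by apply: (immediate_basin_ball Hr) Ox => //; rewrite subrr normc0.
rewrite leNgt; apply/negP => cl.
have [|r r0 Hr] := @horner_near R (iter_poly f m) l (b' - normc (fn m l - p)).
  by rewrite subr_gt0.
have [x [_ _ Kx] /Hr] := Hl r r0; rewrite !horner_iter_poly.
have := normc_tri (fn m x) (fn m l) p; lra.
Qed.

(** * The constant, assembled from two compact sets *)

Lemma kobayashi_near_preimage q1 : Om q1 -> f.[q1] = p -> q1 != p ->
  exists C : R, forall z0, Om z0 ->
    exists2 q : Cplx R, (Om `&` \bigcup_k iter_preimage f k p) q &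
      (kobayashi_dist Om z0 q <= C%:E)%E.
Proof.
move=> Oq1 fq1 q1p; have [q [j [Oq fq nq]]] := generic_preimage Oq1 fq1 q1p.
(* Halving the radius puts the closed disk inside the basin, as [fundamental_domain_closed]
   requires. *)
have [r [r0 [rb rinv]]] : exists r, 0 < r /\ ((forall z, normc (z - p) <= r -> basin f p z) /\
    (forall z, normc (z - p) < r -> normc (f.[z] - p) < r)).
  have [r r0 [Hb Hi]] := attracting_radius; exists (r / 2); split; first by lra.
  split=> [z zr|z]; first by apply: Hb; lra.
  by apply: Hi; lra.
have [m Hm] := critical_tail r0.
have postcritical_in x : postcritical x -> normc (fn m x - p) < r.
  case=> [->|[c [n [cc cb ->]]]]; first by rewrite iter_fixed subrr normc0.
  by rewrite -iterD; apply: Hm => //; exact: leq_addr.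
(* [K 0] contains all of [V]; [K r] contains the points outside [V] whose image is in [V]. *)
pose K b' : set R[i] := [set w | [/\ Om w, normc (fn m.+1 w - p) <= r & b' <= normc (fn m w - p)]].
have [M M0 HM] := poly_proper (normc p + r) (size_iter_poly m.+1 sf).
have KM b' x : K b' x -> normc x <= M.
  move=> [_ xr _]; apply: HM; rewrite horner_iter_poly.
  by have := le_normcD (fn m.+1 x - p) p; rewrite subrK; lra.
have Kcl b' l := @fundamental_domain_closed m r b' l rb.
(* For points of [V] only the identity is lifted. It has no critical points, so [E] can be empty and
   the chain can start at [p]. *)
have [n1 H1] : exists n, forall x, K 0 x -> reaches [set 0%N] n x.
  apply: (@reaches_uniform set0 [set 0%N] p _ _ _ _ _ _ _ _ (KM 0) (Kcl 0)) => //.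
  - by move=> z _; exists 1 => // w _ [].
  - by move=> k y -> /eqP; rewrite derivX hornerC oner_eq0.
  - exact: immediate_basin_fixed.
  - by exists 0%N.
  by move=> x [Ox _ _]; split=> [|[]].
(* All iterates are lifted at once from the generic preimage [q]; by [postcritical_in], [K r]
   contains no postcritical point. *)
have [n2 H2] : exists n, forall x, K r x -> reaches setT n x.
  apply: (@reaches_uniform postcritical setT q _ _ _ _ _ _ _ _ (KM r) (Kcl r)) => //.
  - exact: postcritical_countable.
  - exact: postcritical_closed.
  (* [fn i y] is critical, and [fn k y] has index [k - i.+1] on its orbit counted from the critical
     value. *)
  - move=> k y _ /iter_poly_crit[i ik ci] Oy; right; exists (fn i y), (k - i.+1)%N; split=> //.
      by apply/basin_iter; apply/(basin_iter k); exact: immediate_basin_sub.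
    by rewrite -iterD; congr (iter _ _ _); lia.
  - by exists j.
  by move=> x [Ox _ xr]; split=> // /postcritical_in; rewrite ltNge xr.
have reach_dist n z : (exists q, [/\ Om q, exists j, fn j q = p & linked Om (2 ^+ n) z q]) ->
    exists2 q : Cplx R, (Om `&` \bigcup_k iter_preimage f k p) q &
      (kobayashi_dist Om z q <= (2 ^+ n)%:E)%E.
  move=> [x [Ox [i fi] zx]]; exists x; first by split=> //; exists i.
  by apply: linked_dist zx; rewrite exprn_gt0.
have p1 : 0 <= 2 ^+ n1 :> R by rewrite exprn_ge0.
have p2 : 0 <= 2 ^+ n2 :> R by rewrite exprn_ge0.
exists (2 ^+ n1 + 2 ^+ n2) => z0 Oz0.
have weaken n : 2 ^+ n <= 2 ^+ n1 + 2 ^+ n2 :> R ->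
    (exists q, [/\ Om q, exists j, fn j q = p & linked Om (2 ^+ n) z0 q]) ->
    exists2 q : Cplx R, (Om `&` \bigcup_k iter_preimage f k p) q &
      (kobayashi_dist Om z0 q <= (2 ^+ n1 + 2 ^+ n2)%:E)%E.
  move=> nn /reach_dist[x xp zx]; exists x => //.
  by apply: (le_trans zx); rewrite lee_fin.
have /basinP/(_ r r0)[N /(_ (N + m)%N (leq_addr _ _))] := immediate_basin_sub Oz0.
rewrite addnC iterD => HN.
have exk : exists k, normc (fn m (fn k z0) - p) < r by exists N.
(* If the first entry into [V] is at index 0, then [z0] lies in [K 0]. If it is at [k.+1], then
   [fn k z0] is outside [V] and lies in [K r], and the chain is lifted by the [k]-th iterate back to
   [z0]. *)
have {exk} [[|k] Hk mink] := ex_minnP exk.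
  apply: (weaken n1); first by lra.
  apply: (H1 z0 _ 0%N) => //; split; rewrite ?normc_ge0 //.
  by apply/ltW; exact: rinv.
apply: (weaken n2); first by lra.
apply: (H2 (fn k z0) _ k z0) => //; split.
- exact: immediate_basin_iter.
- by apply/ltW; move: Hk; rewrite [fn k.+1 z0]iterS fnS.
by rewrite leNgt; apply/negP => /mink; rewrite ltnn.
Qed.

End Attracting.

Theorem theorem7 (R : realType) (N : nat) (f : {poly R[i]}) (p : Cplx R)
    (Omega : set (Cplx R)) :
  (2 <= N)%N -> size f = N.+1 ->
  attracting_fixed_point f p ->
  Omega = immediate_basin f p ->
  iter_preimage f 1 p `&` Omega <> [set p] ->
  exists C : R, forall z0 : Cplx R, Omega z0 ->
    exists2 q : Cplx R, (Omega `&` \bigcup_k iter_preimage f k p) q &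
      (kobayashi_dist Omega z0 q <= C%:E)%E.
Proof.
move=> N2 sN fp -> pre.
have sf : (1 < size f)%N by rewrite sN ltnS (leq_trans _ N2).
(* [p] always belongs to the intersection, so the latter differs from [[set p]] only by containing
   another point. *)
have [q1 [Oq1 fq1 q1p]] : exists q1, [/\ immediate_basin f p q1, f.[q1] = p & q1 != p].
  apply: contrapT => H; apply: pre; apply/seteqP; split=> x.
    move=> [/= fx Ox]; apply: contrapT => /eqP xp; apply: H; by exists x.
  by move=> ->; split; [case: fp | exact: immediate_basin_fixed].
exact: (kobayashi_near_preimage sf fp Oq1 fq1 q1p).
Qed.
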